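(* Let $\mathbb{G}$ be a pseudo-orientable ribbon graph and let $Q\subseteq E(\mathbb{G})$. For $i\ge0$ let $q^Q_i$ be the number of quasi-trees $X$ of $\mathbb{G}$ with $|Q\triangle X|\in\{2i-1,2i\}$. Then the sequence $(q^Q_i)_{i\ge0}$ is ultra-log-concave with no internal zeros. In particular, the sequence $(q_i:=q^{\emptyset}_i)_{i\ge0}$ counting quasi-trees of size $2i-1$ or $2i$ is ultra-log-concave with no internal zeros.
   Context: A ribbon graph $\mathbb{G}$ is a surface with boundary written as the union of vertex discs and edge discs $E(\mathbb{G})$ meeting in disjoint line segments, each on the boundary of exactly one vertex and one edge, with each edge containing exactly two such segments. For connected $\mathbb{G}$, a quasi-tree is $F\subseteq E(\mathbb{G})$ such that the spanning ribbon subgraph $(V(\mathbb{G}),F)$ has exactly one boundary component; in general, a union of quasi-trees of the components. The partial dual $\mathbb{G}^X$ has the same edges and as vertices discs glued along the boundary components of $(V(\mathbb{G}),X)$. A bouquet is a ribbon graph with one vertex; a loop is orientable if with the vertex it forms an annulus, non-orientable if a Möbius band. A bouquet is pseudo-orientable if its vertex boundary circle is the union of two closed arcs $S_1,S_2$ meeting in exactly two points such that both ends of each orientable loop lie in the interior of one $S_i$ and each non-orientable loop has one end in the interior of each of $S_1,S_2$. A connected ribbon graph is pseudo-orientable if $\mathbb{G}^X$ is a pseudo-orientable bouquet for some quasi-tree $X$; a general one is pseudo-orientable if one component is pseudo-orientable and all others are orientable. For a finitely supported sequence $(a_i)_{i\in\mathbb{Z}}$ of nonnegative reals with $\ell=\min\{i:a_i\ne0\}$,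 $u=\max\{i:a_i\neq0\}$: it has no internal zeros if $a_i\ne0$ for all $\ell\le i\le u$; it is log-concave if $a_i^2\ge a_{i-1}a_{i+1}$ for all $i$; it is ultra-log-concave if $\bigl(a_i/\binom{u-\ell}{i-\ell}\bigr)_{i}$ is log-concave. *)

(* Defs.v *)
(* Combinatorial (flag / graph-encoded map) model of ribbon graphs. *)
From HB Require Import structures.
From mathcomp Require Import all_boot all_order all_algebra.
Set Implicit Arguments. Unset Strict Implicit. Unset Printing Implicit Defensive.
Import Order.TTheory GRing.Theory Num.Theory.

(* Flags.  Every edge disc e is a rectangle with 4 corners (flags)           *)
(* (e, s, t) : s = which of the two attaching segments ("ends") of e,        *)
(*             t = which of the two long sides of e.                         *)
(*   a0 : swaps the two corners of the same attaching segment (same end);    *)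
(*   a2 : swaps the two corners of the same long side (other end);           *)
(*   a1 : (data) joins a corner to the next corner along the boundary arc    *)
(*        of its vertex disc between consecutive attaching segments.         *)
(* Vertices = orbits of <a0,a1> (plus isolated vertices, counted by iso),    *)
(* edges = E, components = orbits of <a0,a1,a2> (plus isolated vertices).    *)

Definition flag (E : finType) : finType := (E * bool * bool)%type.

Section Flags.
Variable E : finType.
Implicit Types (x : flag E) (X : {set E}).

Definition edge_of x : E := x.1.1.
Definition a0 x : flag E := (x.1.1, x.1.2, ~~ x.2).
Definition a2 x : flag E := (x.1.1, ~~ x.1.2, x.2).

(* ribbon graph: the vertex-boundary involution a1 and the number of
   isolated (edgeless) vertices *)
Record ribbon_graph := RibbonGraph { rg_a1 : flag E -> flag E; rg_iso : nat }.

Definition ribbon_ok (G : ribbon_graph) :=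
  involutive (rg_a1 G) /\ forall x, rg_a1 G x != x.

Definition rel2 (f g : flag E -> flag E) : rel (flag E) :=
  fun x y => (y == f x) || (y == g x).

Definition norbits (f g : flag E -> flag E) (D : {set flag E}) : nat :=
  n_comp (rel2 f g) D.

(* boundary of the spanning ribbon subgraph (V, X): along a1-arcs of vertex
   boundaries, along long sides (a2) of kept edges, along attaching
   segments (a0) of deleted edges *)
Definition beta X x : flag E := if edge_of x \in X then a2 x else a0 x.

Definition nbdry (a1 : flag E -> flag E) X (D : {set flag E}) : nat :=
  norbits a1 (beta X) D.

Definition nverts (a1 : flag E -> flag E) (D : {set flag E}) : nat :=
  norbits a0 a1 D.

Definition conn_rel (a1 : flag E -> flag E) : rel (flag E) :=
  fun x y => [|| y == a0 x, y == a1 x | y == a2 x].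

Definition comp (a1 : flag E -> flag E) x : {set flag E} :=
  [set y | connect (conn_rel a1) x y].

(* partial dual w.r.t. X: exchange the roles of a0 and a2 on the edges of X
   (vertices of G^X are the boundary components of (V,X)); transported back
   to the flag set of G via the relabelling psi X *)
Definition psi X x : flag E :=
  if edge_of x \in X then (x.1.1, x.2, x.1.2) else x.
Definition pdual (G : ribbon_graph) X : ribbon_graph :=
  RibbonGraph (fun x => psi X (rg_a1 G (psi X x))) (rg_iso G).

(* orientability: the flag graph is bipartite (consistent local orientation) *)
Definition orientable_in (a1 : flag E -> flag E) (D : {set flag E}) :=
  exists col : flag E -> bool, forall x, x \in D ->
    [&& col (a0 x) != col x, col (a1 x) != col x & col (a2 x) != col x].

Definition quasi_tree_in (a1 : flag E -> flag E) X (D : {set flag E}) : bool :=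
  nbdry a1 X D == 1%N.

(* in a bouquet, loop e is orientable iff vertex + e is an annulus, i.e. the
   ribbon subgraph (V,{e}) has 2 boundary components (a Moebius band has 1) *)
Definition orientable_loop_in (a1 : flag E -> flag E) (D : {set flag E}) (e : E) :=
  nbdry a1 [set e] D = 2%N.

(* pseudo-orientable bouquet: S is the set of corners lying on the closed arc
   S_1; it is a union of whole ends (closed under a0) and forms one cyclic
   interval of the vertex boundary circle (at most 2 boundary arcs a1 leave
   S); orientable loops have both ends on the same side, non-orientable loops
   one end on each side. *)
Definition ps_or_bouquet_in (a1 : flag E -> flag E) (D : {set flag E}) :=
  nverts a1 D = 1%N /\
  exists S : {set flag E},
    [/\ S \subset D,
        forall x, (a0 x \in S) = (x \in S),
        (#|[set x in S | a1 x \notin S]| <= 2)%N &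
        forall x, x \in D ->
          orientable_loop_in a1 D (edge_of x) <-> ((x \in S) = (a2 x \in S))].

Definition ps_or_conn_in (G : ribbon_graph) (D : {set flag E}) :=
  exists X, quasi_tree_in (rg_a1 G) X D /\ ps_or_bouquet_in (rg_a1 (pdual G X)) D.

(* quasi-tree of a general ribbon graph: union of quasi-trees of the
   components (isolated vertices: only the empty edge set, always fine) *)
Definition quasi_tree (G : ribbon_graph) X : bool :=
  [forall x, quasi_tree_in (rg_a1 G) X (comp (rg_a1 G) x)].

(* one component pseudo-orientable, all others orientable.  An isolated
   vertex is a component that is orientable and pseudo-orientable (it is a
   bouquet with no loops and empty quasi-tree). *)
Definition pseudo_orientable (G : ribbon_graph) :=
  (exists x, ps_or_conn_in G (comp (rg_a1 G) x) /\
     forall y, y \notin comp (rg_a1 G) x ->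
       orientable_in (rg_a1 G) (comp (rg_a1 G) y))
  \/ ((0 < rg_iso G)%N /\ forall y, orientable_in (rg_a1 G) (comp (rg_a1 G) y)).

Definition qseq (G : ribbon_graph) (Q : {set E}) (i : nat) : nat :=
  #|[set X : {set E} | quasi_tree G X &
      let d := #|(Q :\: X) :|: (X :\: Q)| in (d == 2 * i) || (d.+1 == 2 * i)]|.

End Flags.

Local Open Scope ring_scope.

Definition support_bounds (a : nat -> nat) (l u : nat) :=
  [/\ a l != 0%N, a u != 0%N & forall i, a i != 0%N -> (l <= i <= u)%N].

Definition no_internal_zeros (a : nat -> nat) :=
  forall l u, support_bounds a l u -> forall i, (l <= i <= u)%N -> a i != 0%N.

(* log-concavity of a nonnegative sequence indexed by Z, zero at negative
   indices: b_i^2 >= b_{i-1} b_{i+1}; at i = 0 this is trivial *)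
Definition log_concave (b : nat -> rat) :=
  forall i : nat, b i * b i.+2 <= b i.+1 ^+ 2.

Definition ultra_log_concave (a : nat -> nat) :=
  forall l u, support_bounds a l u ->
    log_concave (fun i => (a i)%:R / ('C(u - l, i - l))%:R).

(* Main.v *)
Require Import Defs.
From mathcomp Require Import all_boot all_order all_fingroup all_algebra all_field.
From mathcomp Require Import ring zify.
Set Implicit Arguments. Unset Strict Implicit. Unset Printing Implicit Defensive.
Import Order.TTheory GRing.Theory Num.Theory.
Local Open Scope ring_scope.

(** A two-colouring of the flags that is switched by [a0], [a2] and [a1] turns the boundary
components of (V, X) into the cycles of a permutation [rho * t_X] of the ends of edges, where
[t_X] is the product of the transpositions of the two ends of the edges in [X].  If [K] kills
one end in each component, then [det (1 - K P)] is the indicator that the permutation with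
matrix [P] has one cycle per component.  This determinant is affine in each transposition, so
[sum_X x^|Q + X|] over quasi-trees [X] equals [(1 + x)^|E| det (1 - K M(x))], where [M(x)]
replaces each transposition by a mixture with the identity.  When [Re x > 0] the mixtures are
contractions, and the determinant vanishes only if there is no quasi-tree.  Since all
[|Q + X|] have the same parity, the generating polynomial of the sequence has only real
nonpositive roots, and Newton's inequalities apply.

A pseudo-orientable graph has such a colouring except on two arcs of vertex boundaries.
Reconnecting these arcs in the two ways that respect the colouring gives two orientable
boundary systems, and [X] is a quasi-tree if and only if it is one for exactly one of them.
The choice between the two is itself a transposition, which acts as an extra element and
pairs the odd and even distances. *)

(** * Determinants and cycles of permutations *)

(** The vector [v] fills a single row of the block matrix, so linearity of the determinant in that
    row applies to rank-one perturbations of [N]. *)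
Lemma det_block_schur (R : comNzRingType) n (N : 'M[R]_n) (u : 'cV_n) (v : 'rV_n) :
  \det (block_mx 1%:M (- v) u N) = \det (N + u *m v).
Proof.
have -> : block_mx 1%:M (- v) u N =
    block_mx (1%:M : 'M_1) 0 u 1%:M *m block_mx 1%:M (- v) 0 (N + u *m v).
  by rewrite mulmx_block !mul1mx !mulmx1 !mul0mx mulmxN !addr0 addrCA addNr addr0.
by rewrite det_mulmx det_lblock det_ublock !det1 !mul1r.
Qed.

Lemma det_rank1_affine (R : comNzRingType) n (N : 'M[R]_n) (u : 'cV_n) (v : 'rV_n) c :
  \det (N + c *: (u *m v)) = (1 - c) * \det N + c * \det (N + u *m v).
Proof.
rewrite scalemxAr -!det_block_schur.
have -> : \det N = \det (block_mx (1%:M : 'M_1) (- 0) u N).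
  by rewrite det_block_schur mulmx0 addr0.
apply: (@determinant_multilinear _ _ _ _ _ (lshift n ord0)).
- rewrite /block_mx !rowKu !row_id -[RHS]/(_ *: row_mx _ _ + _ *: row_mx _ _).
  by rewrite !scale_row_mx add_row_mx -scalerDl subrK scale1r oppr0 scaler0 add0r scalerN.
- by rewrite /block_mx !row'Ku !flatmx0.
- by rewrite /block_mx !row'Ku !flatmx0.
Qed.

Lemma porbit1 (T : finType) (s : {perm T}) x : porbit s (s x) = porbit s x.
Proof. by rewrite -[RHS](porbit_perm s 1) expg1. Qed.

Definition killed_perm_mx (C : pzRingType) n (R : {set 'I_n}) (s : 'S_n) : 'M[C]_n :=
  diag_mx (\row_i (i \notin R)%:R) *m perm_mx s.

Definition cycles_meet (T : finType) (R : {set T}) (s : {perm T}) : bool :=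
  [forall x, [exists y in R, y \in porbit s x]].

Lemma killed_perm_mxE (C : pzRingType) n (R : {set 'I_n}) (s : 'S_n) i j :
  killed_perm_mx C R s i j = ((i \notin R) && (s i == j))%:R.
Proof. by rewrite /killed_perm_mx mul_diag_mx !mxE -natrM mulnb. Qed.

Lemma sub_killed_perm_mxE (C : pzRingType) n (R : {set 'I_n}) (s : 'S_n) i j :
  (1%:M - killed_perm_mx C R s) i j = (i == j)%:R - ((i \notin R) && (s i == j))%:R.
Proof. by rewrite -killed_perm_mxE !mxE. Qed.

(** A cycle avoiding [R] has its indicator vector in the kernel. Otherwise only the identity
    contributes to the Leibniz sum, and its diagonal entries are all 1 because every fixed point of
    [s] lies in [R]. *)
Lemma det_sub_killed_perm_mx (C : idomainType) n (R : {set 'I_n}) (s : 'S_n) :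
  \det (1%:M - killed_perm_mx C R s) = (cycles_meet R s)%:R.
Proof.
case: (boolP (cycles_meet R s)) => [/forallP meet | /forallPn[x0 /exists_inPn avoid]]; last first.
  pose w : 'cV[C]_n := \col_i (i \in porbit s x0)%:R.
  have w_ker : (1%:M - killed_perm_mx C R s) *m w = 0.
    rewrite /killed_perm_mx mulmxBl mul1mx -mulmxA -row_permE mul_diag_mx.
    apply/colP => i; rewrite !mxE [s i \in _]porbit_sym porbit1 porbit_sym.
    case: (boolP (i \in R)) => [/avoid /negPf-> | _]; by rewrite ?mulr0 ?mul1r subrr.
  apply/eqP; rewrite -det_tr; apply/det0P; exists w^T.
    apply/eqP => /rowP/(_ x0); rewrite !mxE porbit_id => /eqP.
    by rewrite oner_eq0.
  by rewrite -trmx_mul w_ker trmx0.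
rewrite /determinant (bigD1 1%g) //= odd_perm1 mul1r [X in _ + X]big1 ?addr0.
  rewrite big1 // => i _; rewrite sub_killed_perm_mxE perm1 eqxx.
  case: (altP (s i =P i)) => [si|_]; last by rewrite andbF subr0.
  have /exists_inP[y yR /porbitP[k yE]] := meet i.
  suff -> : i \in R by rewrite subr0.
  suff <- : y = i by [].
  by rewrite yE permX; elim: k {yE} => //= k ->.
(* A permutation t contributing to the Leibniz sum moves each i to i or s i, so the points it
   moves form a union of cycles of s that avoids R. *)
move=> t t1; have [i ti] : exists i, t i != i.
  apply/existsP; apply: contraNT t1 => /existsPn t1.
  by apply/eqP/permP => i; rewrite perm1; apply/eqP/negPn.
case: (boolP [forall k, (t k == k) || (k \notin R) && (s k == t k)]); last first.
  move=> /forallPn[k]; rewrite negb_or => /andP[/negPf tk /negPf sk].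
  rewrite (bigD1 k) //= sub_killed_perm_mxE eq_sym tk sk subr0.
  by rewrite mul0r mulr0.
move=> /forallP step.
have moved k : t ((s ^+ k)%g i) != (s ^+ k)%g i /\ (s ^+ k)%g i \notin R.
  have out j : t j != j -> j \notin R by move=> tj; have := step j; rewrite (negPf tj) => /andP[].
  suff tk : t ((s ^+ k)%g i) != (s ^+ k)%g i by split=> //; apply: out.
  elim: k => [|k IH]; first by rewrite perm1.
  have := step ((s ^+ k)%g i); rewrite (negPf IH) /= => /andP[_ /eqP sE].
  by rewrite expgSr permM sE (inj_eq perm_inj).
have /exists_inP[y yR /porbitP[k yE]] := meet i.
by have [_] := moved k; rewrite -yE yR.
Qed.

(** * Multi-affine functions and interpolation from the vertices of the cube *)

Section Multiaffine.

Variables (K : comNzRingType) (I : finType).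
Implicit Types (c : {ffun I -> K}) (X : {set I}).

Definition ffun_set c i y : {ffun I -> K} := [ffun j => if j == i then y else c j].

Definition set_vec X : {ffun I -> K} := [ffun i => (i \in X)%:R].

Definition multiaffine (g : {ffun I -> K} -> K) :=
  forall c i, g c = (1 - c i) * g (ffun_set c i 0) + c i * g (ffun_set c i 1).

(** Induction on the size of a set [J] outside which all coordinates are 0 or 1: affinity replaces
    one coordinate of [J] by 0 and by 1. *)
Lemma multiaffine_ext g h : multiaffine g -> multiaffine h ->
  (forall X, g (set_vec X) = h (set_vec X)) -> g =1 h.
Proof.
move=> ga ha gh.
suff main m c (J : {set I}) : #|J| = m ->
    (forall i, i \notin J -> c i = 0 \/ c i = 1) -> g c = h c.
  by move=> c; apply: (main _ c setT erefl) => i; rewrite inE.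
elim: m c J => [|m IH] c J cardJ cJ.
  have -> : c = set_vec [set i | c i == 1].
    apply/ffunP => i; rewrite ffunE inE.
    have [->|->] : c i = 0 \/ c i = 1 by apply: cJ; rewrite (cards0_eq cardJ) inE.
      by rewrite eq_sym oner_eq0.
    by rewrite eqxx.
  exact: gh.
have /card_gt0P[i iJ] : (0 < #|J|)%N by rewrite cardJ.
have bin y : y = 0 \/ y = 1 -> g (ffun_set c i y) = h (ffun_set c i y).
  move=> y01; apply: (IH _ (J :\ i)).
    by have := cardsD1 i J; rewrite iJ cardJ => -[].
  move=> k; rewrite !inE ffunE; case: eqP => //= _; exact: cJ.
by rewrite (ga c i) (ha c i) !bin; auto.
Qed.

(** The probability of [X] when each [i] is included independently with probability [c i], for
    arbitrary coefficients. These products are the Lagrange basis on the cube. *)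
Definition weight X c : K := \prod_i (if i \in X then c i else 1 - c i).

Lemma weight_multiaffine X : multiaffine (weight X).
Proof.
move=> c i; rewrite /weight (bigD1 i) //= [X in _ * X + _](bigD1 i) //=.
rewrite [X in _ + _ * X](bigD1 i) //=.
have E y : \prod_(j | j != i) (if j \in X then ffun_set c i y j else 1 - ffun_set c i y j)
         = \prod_(j | j != i) (if j \in X then c j else 1 - c j).
  by apply: eq_bigr => j /negPf ji; rewrite !ffunE ji.
by rewrite !E !ffunE eqxx; case: ifP => _; ring.
Qed.

Lemma weight_set_vec X Y : weight X (set_vec Y) = (X == Y)%:R.
Proof.
case: eqP => [->|/eqP ne].
  by rewrite /weight big1 // => i _; rewrite ffunE; case: (i \in Y); rewrite ?subr0.
have [i iXY] : exists i, (i \in X) != (i \in Y).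
  apply/existsP; apply: contraNT ne => /existsPn XY.
  by apply/eqP/setP => i; apply/eqP/negPn.
rewrite /weight (bigD1 i) //= ffunE; move: iXY.
by case: (i \in X); case: (i \in Y) => //= _; rewrite ?subrr mul0r.
Qed.

Lemma multiaffineE g : multiaffine g ->
  forall c, g c = \sum_X weight X c * g (set_vec X).
Proof.
move=> ga; apply: multiaffine_ext => //.
  move=> c i; rewrite !mulr_sumr -big_split; apply: eq_bigr => X _ /=.
  by rewrite (weight_multiaffine X c i); ring.
move=> X; rewrite (bigD1 X) //= weight_set_vec eqxx mul1r big1 ?addr0 // => Y /negPf ne.
by rewrite weight_set_vec ne mul0r.
Qed.

End Multiaffine.

(** * The Hermitian norm and mixtures of an involution with the identity *)

Section Hermitian.

Variable n : nat.
Implicit Types (u v w : 'rV[algC]_n).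

Definition norm2 v : algC := \sum_i `|v 0 i| ^+ 2.

Lemma norm2_ge0 v : 0 <= norm2 v.
Proof. by apply: sumr_ge0 => i _; rewrite exprn_ge0. Qed.

Lemma norm2_eq0 v : (norm2 v == 0) = (v == 0).
Proof.
apply/eqP/eqP => [|->]; last by rewrite /norm2 big1 // => i _; rewrite mxE normr0 expr0n.
move=> v0; apply/rowP => i; rewrite mxE; apply/eqP.
rewrite -normr_eq0 -sqrf_eq0; apply/eqP.
by apply: (psumr_eq0P _ v0) => // j _; rewrite exprn_ge0.
Qed.

Lemma norm2_perm v (s : 'S_n) : norm2 (v *m perm_mx s) = norm2 v.
Proof.
rewrite -[s]invgK -col_permE /norm2 (reindex_inj (@perm_inj _ s)).
by apply: eq_bigr => i _; rewrite mxE permK.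
Qed.

(** For an involution, [v] and its image have equal norms and a real inner product [S]. When
    [x + y = 1], the last term is the norm lost by mixing. *)
Lemma norm2_mix v (t : 'S_n) (x y : algC) : (t * t = 1)%g ->
  norm2 (x *: v + y *: (v *m perm_mx t)) =
  `|x + y| ^+ 2 * norm2 v - (x * y^* + x^* * y) / 2 * norm2 (v - v *m perm_mx t).
Proof.
move=> tt; have tK i : t (t i) = i by rewrite -permM tt perm1.
have tV : (t^-1 = t)%g by apply/eqP; rewrite eq_invg_mul tt.
have vE i : (v *m perm_mx t) 0 i = v 0 (t i) by rewrite -{1}tV -col_permE mxE.
move: (v *m perm_mx t) vE => w vE.
pose S := \sum_i v 0 i * (v 0 (t i))^*.
have S' : \sum_i v 0 (t i) * (v 0 i)^* = S.
  by rewrite (reindex_inj (@perm_inj _ t)); apply: eq_bigr => i _; rewrite tK.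
have N' : \sum_i v 0 (t i) * (v 0 (t i))^* = norm2 v.
  rewrite [RHS](reindex_inj (@perm_inj _ t)); apply: eq_bigr => i _; exact/esym/normCK.
have N : \sum_i v 0 i * (v 0 i)^* = norm2 v.
  by apply: eq_bigr => i _; exact/esym/normCK.
have -> : norm2 (x *: v + y *: w) =
    (x * x^* + y * y^*) * norm2 v + (x * y^* + x^* * y) * S.
  rewrite mulrDl -{1}N -N' mulrDl -{2}S' /S !mulr_sumr -!big_split /=.
  by apply: eq_bigr => i _; rewrite normCK !mxE vE rmorphD !rmorphM /=; ring.
have -> : norm2 (v - w) = 2 * norm2 v - 2 * S.
  rewrite !mulr2n !mulrDl !mul1r -{1}N -N' opprD -{2}S' /S -!sumrN -!big_split /=.
  by apply: eq_bigr => i _; rewrite normCK !mxE vE rmorphB /=; ring.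
by rewrite normCK rmorphD; field.
Qed.

End Hermitian.

(** Rank one is what makes the determinants below affine in the coefficient of each mixed
    transposition. *)
Lemma sub_tperm_mx_rank1 (C : comNzRingType) n (a b : 'I_n) :
  let u : 'cV[C]_n := delta_mx a 0 - delta_mx b 0 in
  1%:M - perm_mx (tperm a b) = u *m u^T.
Proof.
apply/matrixP => i j; rewrite !mxE big_ord1 !mxE eqxx !andbT.
case: tpermP => [->|->|/eqP/negPf ia /eqP/negPf ib].
- rewrite [a == j]eq_sym [b == j]eq_sym eqxx; case: (altP (a =P b)) => [<-|ab].
    by rewrite !subrr mulr0.
  by rewrite subr0 mul1r.
- rewrite [a == j]eq_sym [b == j]eq_sym eqxx; case: (altP (b =P a)) => [<-|ab].
    by rewrite !subrr mulr0.
  by rewrite sub0r mulN1r opprB.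
- by rewrite ia ib !subrr mul0r.
Qed.

(** The fixed permutations [sI i] allow a switch to act before a fixed permutation; this is needed
    to encode the choice between two reconnections. *)
Definition switch_perm (T I : finType) (r : seq I) (a b : I -> T) (sI : I -> {perm T})
    (rho : {perm T}) (X : {set I}) : {perm T} :=
  (rho * \prod_(i <- r) ((if i \in X then tperm (a i) (b i) else 1) * sI i))%g.

Definition sdist (I : finType) (Q X : {set I}) : nat := #|(Q :\: X) :|: (X :\: Q)|.

(** * Determinants of mixed transpositions and nonvanishing on the right half-plane *)

Section Switch.

Variables (n : nat) (I : finType) (r : seq I).
Variables (a b : I -> 'I_n) (sI : I -> 'S_n) (rho : 'S_n) (R : {set 'I_n}).
Hypothesis r_uniq : uniq r.
Hypothesis r_full : forall i, i \in r.
Implicit Types (X Q : {set I}) (c : {ffun I -> algC}).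
Local Notation switch_perm := (switch_perm r a b sI rho).

Definition mix_factor c i : 'M[algC]_n :=
  ((1 - c i)%:M + c i *: perm_mx (tperm (a i) (b i))) *m perm_mx (sI i).

Definition mix_mx c : 'M[algC]_n := perm_mx rho *m \prod_(i <- r) mix_factor c i.

Definition mix_det c : algC :=
  \det (1%:M - diag_mx (\row_i (i \notin R)%:R) *m mix_mx c).

Lemma mix_mx_set_vec X : mix_mx (set_vec _ X) = perm_mx (switch_perm X).
Proof.
rewrite /mix_mx /switch_perm perm_mxM; congr (_ *m _).
elim: (r) => [|i s IH]; first by rewrite !big_nil perm_mx1.
rewrite !big_cons IH perm_mxM -mulmxE; congr (_ *m _).
rewrite /mix_factor perm_mxM ffunE; congr (_ *m _).
case: (i \in X); first by rewrite subrr scale1r raddf0 add0r.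
by rewrite subr0 scale0r addr0 perm_mx1.
Qed.

Lemma mix_det_set_vec X : mix_det (set_vec _ X) = (cycles_meet R (switch_perm X))%:R.
Proof. by rewrite /mix_det mix_mx_set_vec -det_sub_killed_perm_mx. Qed.

(** As [i] occurs exactly once in [r], varying [c i] changes the matrix by multiples of one fixed
    rank-one matrix. *)
Lemma mix_det_multiaffine : multiaffine mix_det.
Proof.
move=> c i; have := r_uniq; have := r_full i.
rewrite /mix_det /mix_mx => /splitPr[r1 r2].
rewrite cat_uniq /= => /and3P[_ /norP[ir1 _] /andP[ir2 _]].
pose D : 'M[algC]_n := diag_mx (\row_j (j \notin R)%:R).
pose A := D *m perm_mx rho *m \prod_(j <- r1) mix_factor c j.
pose B := perm_mx (sI i) *m \prod_(j <- r2) mix_factor c j.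
have E y : D *m (perm_mx rho *m \prod_(j <- r1 ++ i :: r2) mix_factor (ffun_set c i y) j)
    = A *m ((1 - y)%:M + y *: perm_mx (tperm (a i) (b i))) *m B.
  rewrite big_cat big_cons /= -!mulmxE /A /B !mulmxA.
  have F j (s : seq I) : j \notin s ->
      \prod_(k <- s) mix_factor (ffun_set c j y) k = \prod_(k <- s) mix_factor c k.
    move=> js; apply: eq_big_seq => k ks; rewrite /mix_factor ffunE.
    by case: eqP => // kj; rewrite -kj ks in js.
  by rewrite (F i r1 ir1) (F i r2 ir2) ffunE eqxx.
have cE : c = ffun_set c i (c i).
  by apply/ffunP => j; rewrite ffunE; case: eqP => [->|].
rewrite [in LHS]cE !E.
pose u : 'cV[algC]_n := delta_mx (a i) 0 - delta_mx (b i) 0.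
have {}E y : 1%:M - A *m ((1 - y)%:M + y *: perm_mx (tperm (a i) (b i))) *m B =
    (1%:M - A *m B) + y *: ((A *m u) *m (u^T *m B)).
  have -> : A *m u *m (u^T *m B) = A *m (u *m u^T) *m B by rewrite !mulmxA.
  rewrite -sub_tperm_mx_rank1 -addrA; congr (_ + _).
  rewrite mulmxBr mulmx1 mulmxBl mulmxDr mul_mx_scalar -scalemxAr mulmxDl -!scalemxAl.
  by rewrite scalerBl scale1r scalerBr !opprD opprK addrA.
rewrite !E det_rank1_affine scale0r scale1r addr0.
by rewrite -mulmxA.
Qed.

(** The hypothesis says that the product of [1 - c i] with the conjugate of [c i] has positive real
    part. The loss in [norm2_mix] then has a positive coefficient and vanishes only if the
    transposition fixes [v]. *)
Lemma mix_factor_contraction c i v : 0 < (1 - c i) * (c i)^* + (1 - c i)^* * c i ->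
  (norm2 (v *m mix_factor c i) <= norm2 v) /\
  (norm2 (v *m mix_factor c i) = norm2 v ->
     v *m mix_factor c i = v *m perm_mx (sI i) /\ v *m perm_mx (tperm (a i) (b i)) = v).
Proof.
move=> cpos; rewrite /mix_factor mulmxA norm2_perm mulmxDr mul_mx_scalar -scalemxAr.
rewrite norm2_mix ?tperm2 // subrK normr1 expr1n mul1r.
set d := norm2 (v - _); set k := (_ / 2).
have k0 : 0 < k by rewrite divr_gt0 // ltr0n.
split; first by rewrite lerBlDr lerDl mulr_ge0 ?norm2_ge0 // ltW.
move/eqP; rewrite subr_eq addrC -subr_eq subrr eq_sym mulf_eq0 gt_eqF //=.
rewrite norm2_eq0 subr_eq0 => /eqP vt.
by rewrite -vt -scalerDl subrK scale1r.
Qed.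

(** A null vector is reproduced by a product of contractions, so each of them preserves the norm. By
    the equality case every transposition fixes the vector it meets, so the mixed product acts as
    the permutation of [X], contradicting [det_sub_killed_perm_mx]. *)
Lemma mix_det_neq0 c X : cycles_meet R (switch_perm X) ->
  (forall i, 0 < (1 - c i) * (c i)^* + (1 - c i)^* * c i) -> mix_det c != 0.
Proof.
move=> meetX cpos; apply/negP => /det0P[v v0].
rewrite mulmxBr mulmx1 => /eqP; rewrite subr_eq0 => /eqP vE.
pose D : 'M[algC]_n := diag_mx (\row_i (i \notin R)%:R).
have prodP (s : seq I) w : let P := \prod_(i <- s) mix_factor c i in
    norm2 (w *m P) <= norm2 w /\
    (norm2 (w *m P) = norm2 w -> w *m P =
       w *m perm_mx (\prod_(i <- s) ((if i \in X then tperm (a i) (b i) else 1) * sI i))%g).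
  elim: s w => [|i s IH] w /=; first by rewrite !big_nil perm_mx1 !mulmx1.
  rewrite !big_cons -!mulmxE mulmxA perm_mxM mulmxA.
  have [le1 eq1] := mix_factor_contraction w (cpos i).
  have [le2 eq2] := IH (w *m mix_factor c i).
  split=> [|wE]; first exact: le_trans le2 le1.
  have wE1 : norm2 (w *m mix_factor c i) = norm2 w.
    by apply: le_anti; rewrite le1 -[X in X <= _]wE le2.
  have [{}eq1 wt] := eq1 wE1.
  rewrite eq2 ?wE ?wE1 // eq1 perm_mxM mulmxA.
  by case: ifP => _; rewrite ?perm_mx1 ?mulmx1 ?wt.
have [le1 eq1] := prodP r (v *m D *m perm_mx rho).
rewrite norm2_perm in le1 eq1.
have vDE i : (v *m D) 0 i = v 0 i * (i \notin R)%:R by rewrite mul_mx_diag !mxE.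
have leD i : `|(v *m D) 0 i| ^+ 2 <= `|v 0 i| ^+ 2.
  by rewrite vDE; case: (i \in R); rewrite ?mulr1 // mulr0 normr0 expr0n exprn_ge0.
have vE' : v *m D *m perm_mx rho *m \prod_(i <- r) mix_factor c i = v.
  by rewrite {2}vE /mix_mx !mulmxA.
have eqD : norm2 (v *m D) = norm2 v.
  by apply: le_anti; rewrite ler_sum //= -[X in norm2 X <= _]vE'.
rewrite vE' eqD in eq1.
have /det0P[] : \det (1%:M - killed_perm_mx algC R (switch_perm X)) != 0.
  by rewrite det_sub_killed_perm_mx meetX oner_eq0.
exists v => //; rewrite mulmxBr mulmx1; apply/eqP; rewrite subr_eq0; apply/eqP.
by rewrite {1}eq1 // /killed_perm_mx /switch_perm perm_mxM !mulmxA.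
Qed.

Lemma sum_cycles_meet_neq0 Q (x : algC) X0 : cycles_meet R (switch_perm X0) ->
  0 < x + x^* -> \sum_(X | cycles_meet R (switch_perm X)) x ^+ sdist Q X != 0.
Proof.
move=> meet0 xpos.
have x1 : 0 < `|1 + x| ^+ 2.
  have -> : `|1 + x| ^+ 2 = 1 + (x + x^*) + `|x| ^+ 2.
    by rewrite !normCK rmorphD rmorph1; ring.
  by rewrite ltr_wpDr ?exprn_ge0 // addr_gt0.
have x1n : 1 + x != 0 by apply: contraTneq x1 => ->; rewrite normr0 expr0n ltxx.
(* With this [c], each [i] contributes to [(1 + x) ^+ #|I| * weight X c] a factor [x] if it lies in
   exactly one of [Q] and [X], and 1 otherwise. *)
pose c : {ffun I -> algC} := [ffun i => (if i \in Q then 1 else x) / (1 + x)].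
have c1 i : 1 - c i = (if i \in Q then x else 1) / (1 + x).
  by rewrite ffunE; case: ifP => _; field.
suff -> : \sum_(X | cycles_meet R (switch_perm X)) x ^+ sdist Q X
    = (1 + x) ^+ #|I| * mix_det c.
  rewrite mulf_neq0 ?expf_neq0 //; apply: (mix_det_neq0 meet0) => i.
  rewrite c1 ffunE.
  have normE (z u w : algC) : z != 0 ->
      u / z * (w / z)^* + (u / z)^* * (w / z) = (u * w^* + u^* * w) / `|z| ^+ 2.
    move=> z0; have zc0 : z^* != 0 by rewrite fmorph_eq0.
    by rewrite normCK !rmorphM !fmorphV /=; field; apply/andP; split.
  (* The numerator is [x + x^*] whether or not [i] lies in [Q]. *)
  rewrite normE //.
  by rewrite divr_gt0 //; case: ifP => _; rewrite rmorph1 ?mulr1 ?mul1r // addrC.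
rewrite (multiaffineE mix_det_multiaffine) mulr_sumr big_mkcond; apply: eq_bigr => X _.
rewrite mix_det_set_vec; case: ifP => _; last by rewrite !mulr0.
have -> : (1 + x) ^+ #|I| = \prod_(i : I) (1 + x) by rewrite prodr_const.
rewrite mulr1 /weight -big_split /=.
rewrite -[LHS]prodr_const [LHS]big_mkcond; apply: eq_bigr => i _ /=.
rewrite !inE; case: (boolP (i \in X)) => iX; rewrite ?c1 ?ffunE.
  by case: (i \in Q) => /=; rewrite mulrC divfK.
by case: (i \in Q) => /=; rewrite mulrC divfK.
Qed.

End Switch.

(** * Newton's inequalities *)

(** The inductive step of Newton's inequalities for one more linear factor: the difference of the
    sides is an explicit sum of nonnegative terms. The hypotheses on [B0] carry a factor [k] because
    [B0] has no meaning when [k] is 0. *)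
Lemma newton_step_ge0 (k m : nat) (c B0 B1 B2 B3 : algC) :
  0 <= c -> B1 \is Num.real -> B2 \is Num.real ->
  k%:R * (B0 * B2) <= k%:R * B1 ^+ 2 -> B1 * B3 <= B2 ^+ 2 ->
  k%:R * (B0 * B3) <= k%:R * (B1 * B2) ->
  (k%:R * B0 + m.+2%:R * c * B1) * (k.+2%:R * B2 + m%:R * c * B3) <=
  (k.+1%:R * B1 + m.+1%:R * c * B2) ^+ 2.
Proof.
move=> c0 r1 r2; rewrite -subr_ge0 -mulrBr => lc1; rewrite -subr_ge0 => lc2.
rewrite -subr_ge0 -mulrBr => lc3; rewrite -subr_ge0.
have -> : (k.+1%:R * B1 + m.+1%:R * c * B2) ^+ 2 -
    (k%:R * B0 + m.+2%:R * c * B1) * (k.+2%:R * B2 + m%:R * c * B3) =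
    k.+2%:R * (k%:R * (B1 ^+ 2 - B0 * B2)) + c ^+ 2 * m%:R * m.+2%:R * (B2 ^+ 2 - B1 * B3)
    + c * m%:R * (k%:R * (B1 * B2 - B0 * B3)) + (B1 - c * B2) ^+ 2.
  by rewrite -!(addn1 _.+1) -!(addn1 k) -!(addn1 m) !natrD; ring.
have rc : c \is Num.real by rewrite realE c0.
have sq : 0 <= (B1 - c * B2) ^+ 2 by rewrite -realEsqr rpredB // rpredM.
apply: addr_ge0 => //; apply: addr_ge0; first apply: addr_ge0.
- by apply: mulr_ge0.
- by apply: mulr_ge0 => //; rewrite !mulr_ge0 ?exprn_ge0.
- by apply: mulr_ge0 => //; rewrite mulr_ge0.
Qed.

(** The properties, stable under multiplication by a linear factor, of the coefficients of a
    polynomial with negative roots divided by binomial coefficients. *)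
Definition newton_seq n (b : nat -> algC) :=
  [/\ forall k, (k <= n)%N -> 0 < b k,
      forall k, (n < k)%N -> b k = 0 &
      forall k, b k * b k.+2 <= b k.+1 ^+ 2].

Lemma newton_seq_ge0 n b k : newton_seq n b -> 0 <= b k.
Proof. by case=> bp b0 _; case: (leqP k n) => [/bp/ltW|/b0->]. Qed.

(** The product of two consecutive log-concavity inequalities, divided by [b k.+1 * b k.+2]. *)
Lemma newton_seq_skip n b k : newton_seq n b -> b k * b k.+3 <= b k.+1 * b k.+2.
Proof.
move=> nb; have [bp b0 lc] := nb.
have b_ge0 := newton_seq_ge0 _ nb.
case: (leqP k.+3 n) => [kn|/b0->]; last by rewrite mulr0 mulr_ge0.
have p1 : 0 < b k.+1 * b k.+2 by rewrite mulr_gt0 // bp; lia.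
rewrite -(ler_pM2l p1).
have -> : b k.+1 * b k.+2 * (b k.+1 * b k.+2) = b k.+1 ^+ 2 * b k.+2 ^+ 2 by ring.
have -> : b k.+1 * b k.+2 * (b k * b k.+3) = b k * b k.+2 * (b k.+1 * b k.+3) by ring.
by rewrite ler_pM ?mulr_ge0.
Qed.

Lemma prod_XaddC_newton (s : seq algC) : all (fun c => 0 < c) s ->
  exists2 b, newton_seq (size s) b &
    forall k, (\prod_(c <- s) ('X + c%:P))`_k = 'C(size s, k)%:R * b k.
Proof.
elim: s => [|c s IH] /=.
  move=> _; exists (fun k => (k == 0)%:R).
    by split=> [[]|[]|[|k]] //=; rewrite ?mulr0 ?exprn_ge0.
  by move=> k; rewrite big_nil coef1 bin0n -natrM mulnb andbb.
case/andP => c0 /IH[b nb bE]; set n := size s in nb bE *.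
have [bp b0 lc] := nb.
have b_ge0 := newton_seq_ge0 _ nb.
(* Forced by the identities [E1] and [E2] below; at [k = 0] the meaningless [b k.-1] is multiplied
   by 0. *)
pose b' k := (k%:R * b k.-1 + (n.+1 - k)%:R * c * b k) / n.+1%:R.
have n1 : 0 < n.+1%:R :> algC by rewrite ltr0n.
have n1n : n.+1%:R != 0 :> algC by rewrite gt_eqF.
exists b'.
  split=> [k kn|k kn|k].
  - rewrite divr_gt0 //; case: k kn => [|k] kn.
      by rewrite mul0r add0r subn0 !mulr_gt0 // bp.
    by rewrite ltr_pwDl ?mulr_ge0 ?ler0n ?(ltW c0) // mulr_gt0 ?ltr0n // bp.
  - rewrite /b' (b0 k.-1) ?b0; first by rewrite !mulr0 addr0 mul0r.
      by lia.
    by lia.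
  - case: (leqP k.+1 n) => [kn|kn]; last first.
      have -> : b' k.+2 = 0.
        by rewrite /b' /= !b0 ?mulr0 ?addr0 ?mul0r //; lia.
      by rewrite mulr0 exprn_ge0 // divr_ge0 // ?ler0n // addr_ge0 // !mulr_ge0 // ltW.
    rewrite /b' mulrACA expr_div_n -[_^-1 * _^-1]expr2 exprVn ler_pM2r ?invr_gt0 ?exprn_gt0 //=.
    have [m nE] : exists m, n = (k.+1 + m)%N by exists (n - k.+1)%N; lia.
    have -> : (n.+1 - k = m.+2)%N by lia.
    have -> : (n.+1 - k.+1 = m.+1)%N by lia.
    have -> : (n.+1 - k.+2 = m)%N by lia.
    apply: newton_step_ge0; rewrite ?(ltW c0) ?realE ?b_ge0 ?lc //.
      by case: k {kn nE} => [|k]; rewrite ?mul0r // ler_wpM2l ?ler0n.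
    case: k {kn nE} => [|k]; rewrite ?mul0r // ler_wpM2l ?ler0n //.
    exact: newton_seq_skip nb.
move=> k; rewrite big_cons mulrDl coefD coefXM coefCM !bE /b' mulrA.
apply: (mulIf n1n); rewrite divfK // mulrDl mulrDr !mulrA.
case: k => [|k] /=.
  by rewrite !bin0 subn0 !mulr1 !mul1r !mul0r !add0r; ring.
have E1 : 'C(n.+1, k.+1)%:R * k.+1%:R = n.+1%:R * 'C(n, k)%:R :> algC.
  by rewrite -!natrM mulnC -mul_bin_diag.
have E2 : 'C(n.+1, k.+1)%:R * (n.+1 - k.+1)%:R = n.+1%:R * 'C(n, k.+1)%:R :> algC.
  by rewrite -!natrM mulnC -mul_bin_down.
by rewrite E1 E2; ring.
Qed.

(** Dividing by ['X^l] removes the root 0, so the quotient, of degree [u - l], is a constant times a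
    product of factors ['X + c%:P] with [c] positive. *)
Lemma newton_of_nonpos_roots (g : {poly algC}) (a : nat -> nat) :
  (forall k, g`_k = (a k)%:R) -> (forall y, root g y -> y <= 0) ->
  forall l u, support_bounds a l u ->
  exists2 b, newton_seq (u - l) b &
    forall k, (a (l + k)%N)%:R = (a u)%:R * ('C(u - l, k)%:R * b k).
Proof.
move=> gE groot l u [al au bnd].
have lu : (l <= u)%N by case/andP: (bnd _ al).
pose h := drop_poly l g.
have hE k : h`_k = (a (l + k)%N)%:R by rewrite coef_drop_poly addnC gE.
have szh : size h = (u - l).+1.
  apply/anti_leq/andP; split.
    apply/leq_sizeP => k ku; rewrite hE; case: eqP (bnd (l + k)%N) => [->//|_ /(_ isT)]; lia.
  rewrite ltnNge; apply/negP => /leq_sizeP/(_ _ (leqnn _)) /eqP.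
  by rewrite hE subnKC // pnatr_eq0 (negPf au).
have lead : lead_coef h = (a u)%:R by rewrite lead_coefE szh hE subnKC.
have gh : g = h * 'X^l.
  rewrite -[LHS](poly_take_drop l) (_ : take_poly l g = 0) ?add0r //.
  apply/polyP => k; rewrite coef_take_poly coef0 gE; case: ltnP => // kl.
  by case: eqP (bnd k) => [->//|_ /(_ isT)]; lia.
have [s hs] := closed_field_poly_normal h; rewrite lead in hs.
have aun : (a u)%:R != 0 :> algC by rewrite pnatr_eq0.
have sneg z : z \in s -> z < 0.
  move=> zs; have hz : root h z by rewrite hs rootZ // root_prod_XsubC.
  rewrite lt_neqAle groot ?andbT; last by rewrite gh rootM hz.
  apply: contraTneq hz => ->; rewrite /root horner_coef0 hE addn0 pnatr_eq0 //.
have szs : size s = (u - l)%N.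
  by move: szh; rewrite hs size_scale // size_prod_XsubC => -[].
have [|b nb bE] := @prod_XaddC_newton (map -%R s).
  by rewrite all_map; apply/allP => z /sneg; rewrite /= oppr_gt0.
rewrite size_map szs in nb bE; exists b => // k.
rewrite -hE hs coefZ -bE big_map.
by under [in RHS]eq_bigr => z _ do rewrite polyCN.
Qed.

Lemma ulc_of_nonpos_roots (g : {poly algC}) (a : nat -> nat) :
  (forall k, g`_k = (a k)%:R) -> (forall y, root g y -> y <= 0) ->
  ultra_log_concave a /\ no_internal_zeros a.
Proof.
move=> gE groot; split=> l u lu.
  have [al au bnd] := lu.
  have [b nb aE] := newton_of_nonpos_roots gE groot lu.
  have [bp b0 lc] := nb; have b_ge0 := newton_seq_ge0 _ nb.
  move=> i; rewrite -(ler_rat algC) rmorphM rmorphXn /= !fmorph_div /= !ratr_nat.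
  case: (ltnP i l) => il.
    have -> : a i = 0%N by case: (a i =P 0%N) (bnd i) => // _ /(_ isT); lia.
    by rewrite !mul0r exprn_ge0 // divr_ge0 ?ler0n.
  (* For [k] beyond [u - l] both sides are 0, the quotient because its numerator is. *)
  have ratio k : (a (l + k)%N)%:R / ('C(u - l, l + k - l))%:R = (a u)%:R * b k :> algC.
    rewrite aE addKn; case: (leqP k (u - l)) => kn.
      by rewrite [_ * b k]mulrC mulrA mulfK // pnatr_eq0 -lt0n bin_gt0.
    by rewrite b0 // !mulr0 mul0r.
  have -> : i = (l + (i - l))%N by lia.
  rewrite -!addnS !ratio mulrACA exprMn -expr2 ler_pM2l ?exprn_gt0 ?ltr0n ?lt0n //.
move=> i /andP[li iu].
have [b [bp _ _] aE] := newton_of_nonpos_roots gE groot lu.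
have [_ au _] := lu.
have := aE (i - l)%N; rewrite subnKC // => E.
rewrite -(pnatr_eq0 algC) E !mulf_neq0 ?pnatr_eq0 // -?lt0n ?bin_gt0 ?leq_sub2r //.
by rewrite gt_eqF // bp // leq_sub2r.
Qed.

(** The fixed parity makes the sum, times [x ^+ p], a polynomial [g] in [x ^+ 2]. Both square roots
    of a root [y] of [g] avoid the open right half-plane, so they are purely imaginary and [y] is
    nonpositive. *)
Lemma ulc_of_halfplane (I : finType) (P : pred {set I}) (Q : {set I}) (p : bool) :
  (forall X, P X -> odd (sdist Q X) = p) ->
  (forall x : algC, 0 < x + x^* -> \sum_(X | P X) x ^+ sdist Q X != 0) ->
  let a i := #|[set X | P X & (sdist Q X == 2 * i)%N || ((sdist Q X).+1 == 2 * i)%N]| in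
  ultra_log_concave a /\ no_internal_zeros a.
Proof.
move=> par nz a.
(* [uphalf d] is the index [i] for which [d] or [d.+1] equals [2 * i]. *)
pose g : {poly algC} := \sum_(X | P X) 'X^(uphalf (sdist Q X)).
apply: (@ulc_of_nonpos_roots g).
  move=> k; rewrite coef_sum /a -sum1_card natr_sum big_mkcond [RHS]big_mkcond /=.
  apply: eq_bigr => X _; rewrite inE coefXn; case: (P X) => //=.
  have -> : (k == uphalf (sdist Q X)) = (sdist Q X == 2 * k)%N || ((sdist Q X).+1 == 2 * k)%N.
    by lia.
  by case: (_ || _).
move=> y gy.
have Re_le0 x : x ^+ 2 = y -> ~~ (0 < x + x^*).
  move=> xE; apply/negP => xpos.
  have gx : x ^+ p * \sum_(X | P X) x ^+ sdist Q X = g.[y].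
    rewrite /g horner_sum mulr_sumr; apply: eq_bigr => X PX.
    rewrite hornerXn -xE -exprM -exprD -(par X PX); congr (_ ^+ _); lia.
  have x0 : x != 0 by apply: contraTneq xpos => ->; rewrite conjC0 addr0 ltxx.
  by move/rootP/eqP: gy; rewrite -gx mulf_eq0 expf_eq0 (negPf x0) andbF (negPf (nz x xpos)).
have [x xE] : exists x, x ^+ 2 = y by exists (sqrtC y); rewrite sqrtCK.
have xr : x + x^* \is Num.real by rewrite CrealE rmorphD /= conjCK addrC.
have /eqP xx : x + x^* == 0.
  have := Re_le0 x xE; have := Re_le0 (- x); rewrite sqrrN rmorphN -opprD oppr_gt0 => /(_ xE).
  by case: (real_ltgt0P xr).
have -> : y = - (x * x^*) by rewrite -xE -[x^*](addKr x) xx addr0 mulrN opprK.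
by rewrite -normCK oppr_le0 exprn_ge0.
Qed.

(** * Switched permutations *)

Section RankPerm.

Variable T : finType.
Implicit Types (s t : {perm T}).

Lemma rank_perm_inj s : injective (fun i : 'I_#|T| => enum_rank (s (enum_val i))).
Proof. by move=> i j /enum_rank_inj/perm_inj/enum_val_inj. Qed.

(** Conjugation by [enum_rank], since matrices are indexed by ordinals. *)
Definition rank_perm s : 'S_#|T| := perm (@rank_perm_inj s).

Lemma rank_permE s x : rank_perm s (enum_rank x) = enum_rank (s x).
Proof. by rewrite permE enum_rankK. Qed.

Lemma rank_permP (s : {perm T}) (s' : 'S_#|T|) :
  (forall x, s' (enum_rank x) = enum_rank (s x)) -> rank_perm s = s'.
Proof. by move=> E; apply/permP => i; rewrite -[i]enum_valK rank_permE E. Qed.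

Lemma rank_perm1 : rank_perm 1 = 1%g.
Proof. by apply: rank_permP => x; rewrite !perm1. Qed.

Lemma rank_permM s t : rank_perm (s * t) = (rank_perm s * rank_perm t)%g.
Proof. by apply: rank_permP => x; rewrite !permM !rank_permE. Qed.

Lemma rank_perm_tperm x y : rank_perm (tperm x y) = tperm (enum_rank x) (enum_rank y).
Proof. by apply: rank_permP => z; rewrite (inj_tperm _ _ _ enum_rank_inj). Qed.

Lemma rank_perm_porbit s x y :
  (enum_rank y \in porbit (rank_perm s) (enum_rank x)) = (y \in porbit s x).
Proof.
have E k : (rank_perm s ^+ k)%g (enum_rank x) = enum_rank ((s ^+ k)%g x).
  by elim: k => [|k IH]; rewrite ?perm1 // !expgSr !permM IH rank_permE.
apply/porbitP/porbitP => -[k kE]; exists k; last by rewrite E kE.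
by apply: enum_rank_inj; rewrite kE E.
Qed.

Lemma rank_perm_cycles_meet (R : {set T}) s :
  cycles_meet [set enum_rank x | x in R] (rank_perm s) = cycles_meet R s.
Proof.
apply/forallP/forallP => meet x.
  have /exists_inP[_ /imsetP[y yR ->]] := meet (enum_rank x).
  by rewrite rank_perm_porbit => yx; apply/exists_inP; exists y.
have /exists_inP[y yR yx] := meet (enum_val x).
by apply/exists_inP; exists (enum_rank y); rewrite ?imset_f // -[x]enum_valK rank_perm_porbit.
Qed.

Lemma rank_perm_switch (I : finType) (r : seq I) (a b : I -> T) sI rho (X : {set I}) :
  rank_perm (switch_perm r a b sI rho X) =
  switch_perm r (enum_rank \o a) (enum_rank \o b) (rank_perm \o sI) (rank_perm rho) X.
Proof.
rewrite /switch_perm rank_permM; congr (_ * _)%g.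
elim: r => [|i r IH]; first by rewrite !big_nil rank_perm1.
rewrite !big_cons -IH !rank_permM /=; congr (_ * _ * _)%g.
by case: ifP => _; rewrite ?rank_perm1 // rank_perm_tperm.
Qed.

End RankPerm.

Section ClassTransitive.

Variables (T : finType) (C : eqType) (cls : T -> C).
Implicit Types (s t : {perm T}).

Definition class_transitive s : bool :=
  [forall x, forall y, (cls x == cls y) ==> (y \in porbit s x)].

(** [pick] depends only on the predicate, so each class has exactly one representative. *)
Definition class_reps : {set T} := [set x | [pick y | cls y == cls x] == Some x].

Lemma class_porbit s x y : (forall z, cls (s z) = cls z) -> y \in porbit s x -> cls y = cls x.
Proof.
move=> sc /porbitP[k ->]; elim: k => [|k IH]; first by rewrite perm1.
by rewrite expgSr permM sc.
Qed.

(** A cycle stays inside one class, and a class has a single representative; so when every cycle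
    meets the representatives, no class contains two cycles. *)
Lemma cycles_meet_class_reps s : (forall z, cls (s z) = cls z) ->
  cycles_meet class_reps s = class_transitive s.
Proof.
move=> sc; apply/idP/idP.
  move/forallP => meet; apply/forallP => x; apply/forallP => y; apply/implyP => /eqP xy.
  have /exists_inP[u] := meet x; rewrite inE => /eqP uE xu.
  have /exists_inP[w] := meet y; rewrite inE => /eqP wE yw.
  have uw : u = w.
    apply: Some_inj; rewrite -uE -wE; apply: eq_pick => z.
    by rewrite (class_porbit sc xu) (class_porbit sc yw) xy.
  by move: xu yw; rewrite uw -!eq_porbit_mem => /eqP-> /eqP<-.
move=> /forallP tr; apply/forallP => x; apply/exists_inP.
case: (pickP (fun y => cls y == cls x)) => [y /eqP yx|/(_ x)]; last by rewrite eqxx.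
case E : [pick y | cls y == cls x] => [u|]; last first.
  by move: E; case: pickP => // /(_ x); rewrite eqxx.
have ux : cls u = cls x by move: E; case: pickP => // z /eqP zx [<-].
exists u; last by have /forallP/(_ u) := tr x; rewrite ux eqxx.
by rewrite inE -E; apply/eqP/eq_pick => z; rewrite ux.
Qed.

(** Both permutations have the classes as their cycles, and the number of cycles determines the
    parity. *)
Lemma class_transitive_odd s t :
  (forall z, cls (s z) = cls z) -> (forall z, cls (t z) = cls z) ->
  class_transitive s -> class_transitive t -> odd_perm s = odd_perm t.
Proof.
have E (u : {perm T}) x : (forall z, cls (u z) = cls z) -> class_transitive u ->
    porbit u x = [set y | cls x == cls y].
  move=> uc /forallP/(_ x)/forallP tr; apply/setP => y; rewrite inE.
  apply/idP/idP => [/(class_porbit uc)->|xy]; first exact: eqxx.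
  by have := tr y; rewrite xy.
move=> sc tc st tt; rewrite /odd_perm; congr (_ (+) odd #|pred_of_set _|).
by apply: eq_imset => x; rewrite !E.
Qed.

End ClassTransitive.

Lemma odd_sdist (I : finType) (Q X : {set I}) : odd (sdist Q X) = odd #|Q| (+) odd #|X|.
Proof.
rewrite /sdist cardsU (_ : (Q :\: X) :&: (X :\: Q) = set0).
  by rewrite cards0 subn0 -(cardsID X Q) -(cardsID Q X) setIC; lia.
by apply/setP => i; rewrite !inE; case: (i \in X); case: (i \in Q).
Qed.

Section SwitchUlc.

Variables (T I : finType) (r : seq I) (a b : I -> T).
Variables (sI : I -> {perm T}) (rho : {perm T}) (C : eqType) (cls : T -> C).
Hypothesis r_uniq : uniq r.
Hypothesis r_full : forall i, i \in r.
Hypothesis ab_neq : forall i, a i != b i.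
Hypothesis ab_cls : forall i, cls (a i) = cls (b i).
Hypothesis sI_cls : forall i z, cls (sI i z) = cls z.
Hypothesis rho_cls : forall z, cls (rho z) = cls z.
Local Notation pi := (switch_perm r a b sI rho).

Lemma switch_perm_cls X z : cls (pi X z) = cls z.
Proof.
rewrite /switch_perm permM -[RHS]rho_cls; move: (rho z) => {}z.
elim: (r) z => [|i s IH] z; first by rewrite big_nil perm1.
rewrite big_cons permM IH permM sI_cls; case: ifP => _; last by rewrite perm1.
by case: tpermP => // ->; rewrite ab_cls.
Qed.

(** Each element of [X] contributes one genuine transposition, as [a i] and [b i] differ. *)
Lemma odd_switch_perm X : odd_perm (pi X) = odd_perm (pi set0) (+) odd #|X|.
Proof.
have -> : #|X| = count (mem X) r.
  rewrite -size_filter -(card_uniqP (filter_uniq _ r_uniq)).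
  by apply: eq_card => i; rewrite mem_filter r_full andbT.
rewrite /switch_perm !odd_permM -addbA; congr (_ (+) _).
elim: (r) => [|i s IH]; first by rewrite !big_nil /= addbF.
rewrite !big_cons !odd_permM IH /= inE oddD odd_perm1.
case: (i \in X); rewrite ?odd_tperm ?ab_neq ?odd_perm1.
  by case: (odd_perm (sI i)); case: (odd_perm _); case: (odd _).
by rewrite addbA.
Qed.

Lemma class_transitive_switch_odd X Y :
  class_transitive cls (pi X) -> class_transitive cls (pi Y) -> odd #|X| = odd #|Y|.
Proof.
move=> tX tY; have := class_transitive_odd (switch_perm_cls X) (switch_perm_cls Y) tX tY.
by rewrite (odd_switch_perm X) (odd_switch_perm Y) => /addbI.
Qed.

Lemma switch_ulc (Q : {set I}) :
  let a i := #|[set X | class_transitive cls (pi X) &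
                (sdist Q X == 2 * i)%N || ((sdist Q X).+1 == 2 * i)%N]| in
  ultra_log_concave a /\ no_internal_zeros a.
Proof.
(* Without any transitive set the sequence is zero and has no support bounds. *)
case: (pickP (fun X => class_transitive cls (pi X))) => [X0 tX0|none]; last first.
  by move=> a'; split=> l u [] /eqP[]; apply/eqP; rewrite cards_eq0; apply/eqP/setP => X;
     rewrite !inE none.
apply: (@ulc_of_halfplane _ (fun X => class_transitive cls (pi X)) _ (odd #|Q| (+) odd #|X0|)).
  by move=> X tX; rewrite odd_sdist (class_transitive_switch_odd tX tX0).
pose R := [set enum_rank x | x in class_reps cls].
have E X : class_transitive cls (pi X) = cycles_meet R (switch_perm r
    (enum_rank \o a) (enum_rank \o b) (@rank_perm T \o sI) (rank_perm rho) X).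
  rewrite -rank_perm_switch rank_perm_cycles_meet cycles_meet_class_reps //.
  exact: switch_perm_cls.
move=> x xpos; under eq_bigl => X do rewrite E.
by apply: sum_cycles_meet_neq0 => //; rewrite -E; exact: tX0.
Qed.

End SwitchUlc.

(** * Boundary components as cycles *)

Section TwoInvolutions.

Variables (E : finType).
Local Notation T := (flag E).
Implicit Types (f g : T -> T) (c : T -> bool).

Lemma rel2_sym f g : involutive f -> involutive g -> connect_sym (rel2 f g).
Proof.
move=> fK gK; apply: sym_connect_sym => x y; rewrite /rel2.
by rewrite -(can_eq fK y) fK -(can_eq gK y (g x)) gK eq_sym [g y == x]eq_sym.
Qed.

Lemma connect_rel2l f g x : connect (rel2 f g) x (f x).
Proof. by apply: connect1; rewrite /rel2 eqxx. Qed.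

Lemma connect_rel2r f g x : connect (rel2 f g) x (g x).
Proof. by apply: connect1; rewrite /rel2 eqxx orbT. Qed.

Lemma connect_rel2C f g : connect (rel2 f g) =2 connect (rel2 g f).
Proof. by apply: eq_connect => x y; rewrite /rel2 orbC. Qed.

Lemma connect_rel2_sub f g (e : rel T) :
  (forall x, connect e x (f x)) -> (forall x, connect e x (g x)) ->
  subrel (connect (rel2 f g)) (connect e).
Proof.
by move=> ef eg; apply: connect_sub => x y /orP[] /eqP->.
Qed.

(** The orbits of the group generated by [f] and [g] are cycles alternating between the two, hence
    of even length. *)
Lemma involutions_two_colorable f g : involutive f -> involutive g ->
  (forall x, f x != x) -> (forall x, g x != x) ->
  exists c, (forall x, c (f x) = ~~ c x) /\ (forall x, c (g x) = ~~ c x).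
Proof.
move=> fK gK fx gx.
have gfI : injective (fun x => g (f x)) by move=> x y /(inv_inj gK)/(inv_inj fK).
pose s := perm gfI.
have sE x : s x = g (f x) by rewrite permE.
have s_fg x : s (f (g x)) = x by rewrite sE fK gK.
(* Descent in steps of two: if [f x] is the image of [x] under the power [k.+2] of [s], then
   [f (s x)] is the image of [s x] under the power [k]. Exponents 0 and 1 are excluded because [f]
   and [g] have no fixed points. *)
have fNs k : forall x, f x != (s ^+ k)%g x.
  have [m] := ubnP k; elim: m k => // m IH [|[|k]] km x; first by rewrite perm1.
    by rewrite expg1 sE eq_sym.
  apply/eqP => E0; have /negP[] : f (s x) != (s ^+ k)%g (s x) by apply: IH; lia.
  apply/eqP/(@perm_inj _ s); rewrite [in LHS](sE x) s_fg E0.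
  by rewrite expgSr permM expgS permM.
have f_porbit x : porbit s (f x) != porbit s x.
  rewrite eq_porbit_mem; apply/porbitP => -[k /eqP]; exact/negP.
have g_porbit x : porbit s (g x) = porbit s (f x).
  by rewrite -[RHS]porbit1 sE fK.
have fg_porbit x : porbit s (f (g x)) = porbit s x.
  by rewrite -[LHS]porbit1 s_fg.
(* Each joint orbit of [f] and [g] consists of two cycles of [s], which both involutions exchange;
   the colour tells which one has the smaller rank. *)
exists (fun x => (enum_rank (porbit s x) < enum_rank (porbit s (f x)))%N).
have step x : ~~ (enum_rank (porbit s x) < enum_rank (porbit s (f x)))%N =
    (enum_rank (porbit s (f x)) < enum_rank (porbit s x))%N.
  rewrite -leqNgt leq_eqVlt; case: eqP => // /val_inj/enum_rank_inj/eqP.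
  by rewrite (negPf (f_porbit x)).
by split=> x; rewrite step ?fK // g_porbit fg_porbit.
Qed.

End TwoInvolutions.

(** * Reconnecting two arcs in a system of closed curves *)

Section Smoothing.

Variables (E : finType).
Local Notation T := (flag E).
Variables (f g : T -> T) (c : T -> bool) (B : pred T).
Hypotheses (fK : involutive f) (gK : involutive g).
Hypotheses (fc : forall x, c (f x) = ~~ c x) (gc : forall x, c (g x) = ~~ c x).
Hypothesis fB : forall x, B (f x) = B x.

(** The strands left after removing the [f]-arcs at the flags of [B]. *)
Definition cut_rel : rel T := fun x y => (y == g x) || ~~ B x && (y == f x).

Lemma cut_rel_sym : connect_sym cut_rel.
Proof.
apply: sym_connect_sym => x y; rewrite /cut_rel.
rewrite -(can_eq gK y (g x)) gK [g y == x]eq_sym; congr (_ || _).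
apply/andP/andP => -[nB /eqP xy]; first by rewrite xy fB fK eqxx.
by rewrite xy fB fK eqxx.
Qed.

(* Following the strand out of p, the colours force it to run into a removed arc at one of the
   two ends whose colour is opposite to that of p. *)
Lemma cut_rel_reach p q : (forall z, B z -> c z = ~~ c p -> z = f p \/ z = f q) ->
  connect cut_rel p (f p) \/ connect cut_rel p (f q).
Proof.
move=> Bp; apply/orP; apply/negPn; rewrite negb_or; apply/negP => /andP[Np Nq].
pose h x := f (g x).
have hI : injective h by move=> x y /(inv_inj fK)/(inv_inj gK).
have walk n : connect cut_rel p (iter n h p) /\ c (iter n h p) = c p.
  elim: n => [|n [IHp IHc]]; first by split.
  rewrite iterS /h fc gc negbK; split=> //; move: IHp IHc; move: (iter n h p) => w pw cw.
  have pgw : connect cut_rel p (g w).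
    by apply: connect_trans pw (connect1 _); rewrite /cut_rel eqxx.
  apply: (connect_trans pgw); apply: connect1; rewrite /cut_rel eqxx andbT.
  apply/orP; right; apply/negP => /Bp; rewrite gc cw => /(_ erefl) [] E0.
    by rewrite -E0 pgw in Np.
  by rewrite -E0 pgw in Nq.
(* Since [h] is injective, the walk returns to [p]; the flag just before it is [f p], reached
   without using a removed arc. *)
have := iter_order hI p; have := fingraph.order_gt0 h p; case: (fingraph.order h p) => // n _.
rewrite iterS => hp; have [pw _] := walk n; case/negP: Np.
have <- : g (iter n h p) = f p by rewrite -[in RHS]hp fK.
by apply: connect_trans pw (connect1 _); rewrite /cut_rel eqxx.
Qed.

Variables p q : T.
Hypothesis pq : c q = c p.
Hypothesis Bpq : forall z, B z -> z \in [:: p; q; f p; f q].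

(** The strand from each of the four ends leads to an end of the opposite colour; combining the four
    statements leaves the two perfect matchings. *)
Lemma cut_rel_pairing :
  connect cut_rel p (f p) /\ connect cut_rel q (f q) \/
  connect cut_rel p (f q) /\ connect cut_rel q (f p).
Proof.
have sym := cut_rel_sym.
have side z : B z -> if c z == c p then z = p \/ z = q else z = f p \/ z = f q.
  by move/Bpq; rewrite !inE => /or4P[] /eqP->; rewrite ?fc ?pq ?eqxx; auto;
     case: (c p) => /=; auto.
have from_p : connect cut_rel p (f p) \/ connect cut_rel p (f q).
  by apply: cut_rel_reach => z /side; case: (c z); case: (c p) => //= H _; case: H; auto.
have from_q : connect cut_rel q (f p) \/ connect cut_rel q (f q).
  suff : connect cut_rel q (f q) \/ connect cut_rel q (f p) by case; auto.
  apply: cut_rel_reach => z /side; rewrite pq.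
  by case: (c z); case: (c p) => //= H _; case: H; auto.
have from_fp : connect cut_rel (f p) p \/ connect cut_rel (f p) q.
  have := @cut_rel_reach (f p) (f q); rewrite !fK fc; apply=> z /side.
  by case: (c z); case: (c p) => //= H _; case: H; auto.
have from_fq : connect cut_rel (f q) q \/ connect cut_rel (f q) p.
  have := @cut_rel_reach (f q) (f p); rewrite !fK fc pq; apply=> z /side.
  by case: (c z); case: (c p) => //= H _; case: H; auto.
rewrite ![connect _ (f _) _]sym in from_fp from_fq.
case: from_p => [pfp|pfq]; case: from_q => [qfp|qfq]; auto.
  case: from_fq => [|pfq]; first by auto.
  by right.
case: from_fp => [|qfp]; last by auto.
by left.
Qed.

Lemma cut_rel_sub (h : T -> T) : (forall z, ~~ B z -> h z = f z) ->
  subrel (connect cut_rel) (connect (rel2 h g)).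
Proof.
move=> hf; apply: connect_sub => x y /orP[/eqP->|/andP[nB /eqP->]].
  exact: connect_rel2r.
by rewrite -hf //; apply: connect_rel2l.
Qed.

Variables (f1 fX : T -> T).
Hypotheses (f1K : involutive f1) (fXK : involutive fX).
Hypotheses (f1f : forall z, ~~ B z -> f1 z = f z) (fXf : forall z, ~~ B z -> fX z = f z).
Hypotheses (f1p : f1 p = q) (f1fp : f1 (f p) = f q).
Hypotheses (fXp : fX p = f q) (fXq : fX q = f p).

Lemma rematch_sub (h : T -> T) (e : rel T) : connect_sym e ->
  (forall z, ~~ B z -> h z = f z) -> subrel (connect cut_rel) (connect e) ->
  (forall z, z \in [:: p; q; f p; f q] -> connect e z (h z)) ->
  subrel (connect (rel2 h g)) (connect e).
Proof.
move=> es hf ce eB; apply: connect_rel2_sub => x.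
  case: (boolP (B x)) => [/Bpq/eB//|nB]; rewrite hf //.
  by apply/ce/connect1; rewrite /cut_rel eqxx nB orbT.
by apply/ce/connect1; rewrite /cut_rel eqxx.
Qed.

Let f1q : f1 q = p. Proof. by rewrite -f1p f1K. Qed.
Let f1fq : f1 (f q) = f p. Proof. by rewrite -f1fp f1K. Qed.

(** Strands join opposite colours and the new arcs of [f1] join equal ones, so under either pairing
    of the strands [f1] merges all four ends into one curve. *)
Lemma crossing_coarser : subrel (connect (rel2 f g)) (connect (rel2 f1 g)).
Proof.
have sym := rel2_sym f1K gK; have sub := cut_rel_sub f1f.
apply: rematch_sub => // z.
suff Ep : connect (rel2 f1 g) p (f p).
  suff Eq : connect (rel2 f1 g) q (f q).
    by rewrite !inE => /or4P[] /eqP->; rewrite ?fK // sym.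
  have Epq := connect_rel2l f1 g p; rewrite f1p in Epq.
  have Efpq := connect_rel2l f1 g (f p); rewrite f1fp in Efpq.
  by rewrite sym in Epq; apply: connect_trans Epq (connect_trans Ep Efpq).
have Efpq := connect_rel2l f1 g (f q); rewrite f1fq in Efpq.
case: cut_rel_pairing => -[pp qq]; first exact: sub.
exact: connect_trans (sub _ _ pp) Efpq.
Qed.

(** Of the two colour-respecting matchings [f] and [fX], the one that differs from the pairing of
    the strands also merges all four ends. *)
Lemma crossing_resolution : subrel (connect (rel2 f1 g)) (connect (rel2 f g)) \/
  subrel (connect (rel2 f1 g)) (connect (rel2 fX g)).
Proof.
case: cut_rel_pairing => -[pp qq]; [right|left]; apply: rematch_sub.
- exact: rel2_sym.
- by [].
- exact: cut_rel_sub.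
- have sym := rel2_sym fXK gK; have sub := cut_rel_sub fXf.
  have X1 := connect_rel2l fX g p; rewrite fXp in X1.
  have X2 := connect_rel2l fX g q; rewrite fXq in X2.
  have pq1 : connect (rel2 fX g) p q.
    by apply: connect_trans (sub _ _ pp) _; rewrite sym.
  have pq2 : connect (rel2 fX g) (f p) (f q).
    by rewrite sym in X2; apply: connect_trans X2 (sub _ _ qq).
  by move=> z; rewrite !inE => /or4P[] /eqP->; rewrite ?f1p ?f1q ?f1fp ?f1fq // sym.
- exact: rel2_sym.
- by [].
- exact: cut_rel_sub.
- have sym := rel2_sym fK gK; have sub := cut_rel_sub (fun z _ => erefl (f z)).
  have X1 := connect_rel2l f g p; have X2 := connect_rel2l f g q.
  have pq1 : connect (rel2 f g) p q.
    by apply: connect_trans (sub _ _ pp) _; rewrite sym.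
  have pq2 : connect (rel2 f g) (f p) (f q).
    by rewrite sym in X1; apply: connect_trans X1 (sub _ _ pp).
  by move=> z; rewrite !inE => /or4P[] /eqP->; rewrite ?f1p ?f1q ?f1fp ?f1fq // sym.
Qed.

End Smoothing.

Section FlagInvolutions.

Variable E : finType.
Implicit Types (x : flag E) (X : {set E}).

Lemma a0K : involutive (@a0 E).
Proof. by case=> [[e s] t]; rewrite /a0 /= negbK. Qed.

Lemma a2K : involutive (@a2 E).
Proof. by case=> [[e s] t]; rewrite /a2 /= negbK. Qed.

Lemma a0a2 x : a0 (a2 x) = a2 (a0 x).
Proof. by []. Qed.

Lemma a0_neq x : a0 x != x.
Proof. by apply/eqP => /(congr1 snd) /=; case: x.2. Qed.

Lemma betaK X : involutive (beta X).
Proof.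
move=> x; rewrite /beta; case: (boolP (edge_of x \in X)) => eX.
  by rewrite (_ : edge_of (a2 x) = edge_of x) // eX a2K.
by rewrite (_ : edge_of (a0 x) = edge_of x) // (negPf eX) a0K.
Qed.

Lemma edge_flags x z : edge_of z = edge_of x -> z \in [:: x; a2 x; a0 x; a0 (a2 x)].
Proof.
case: x z => [[e s] t] [[e' s'] t']; rewrite /edge_of /= => ->.
rewrite !inE /a0 /a2 /= !xpair_eqE eqxx /=.
by case: s; case: t; case: s'; case: t'.
Qed.

End FlagInvolutions.

Section Ends.

Variables (E : finType) (c : flag E -> bool).
Hypothesis c0 : forall x, c (a0 x) = ~~ c x.
Local Notation dart := (E * bool)%type.
Implicit Types (d : dart) (x : flag E) (X : {set E}) (f : flag E -> flag E).

(* (e, s) stands for the end s of the edge e; exactly one of its two corners has colour true. *)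
Definition pos_flag d : flag E := (d, c (d, true)).

Lemma pos_flagT d : c (pos_flag d).
Proof.
rewrite /pos_flag; case E0 : (c (d, true)) => //.
by have := c0 (d, true); rewrite E0 /a0 /= -surjective_pairing => ->.
Qed.

Lemma pos_flagK x : c x -> pos_flag x.1 = x.
Proof.
case: x => d [] cx; rewrite /pos_flag /=; first by rewrite cx.
by have := c0 (d, true); rewrite /a0 /= -surjective_pairing cx => /esym/negbTE->.
Qed.

Lemma neg_flagK x : ~~ c x -> a0 (pos_flag x.1) = x.
Proof.
move=> cx; apply: (inv_inj (@a0K E)); rewrite a0K -[RHS]pos_flagK ?c0 //.
by case: (x) => [[]].
Qed.

(** When [f] switches colours, it takes the positive corner of [d] to the negative corner of the
    next end. *)
Definition rot_fun f d : dart := (f (pos_flag d)).1.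

Definition edge_swap X : {perm dart} :=
  (\prod_(e <- enum E) (if e \in X then tperm (e, true) (e, false) else 1))%g.

Lemma edge_swapE X d : edge_swap X d = if d.1 \in X then (d.1, ~~ d.2) else d.
Proof.
rewrite /edge_swap; suff main s : uniq s ->
    ((\prod_(e <- s) (if e \in X then tperm (e, true) (e, false) else 1))%g : {perm dart}) d
    = if (d.1 \in X) && (d.1 \in s) then (d.1, ~~ d.2) else d.
  by rewrite main ?enum_uniq // mem_enum andbT.
elim: s d => [|e s IH] d /=; first by rewrite big_nil perm1 in_nil andbF.
case/andP => es us; rewrite big_cons permM IH // inE.
case: (altP (d.1 =P e)) => [de|/negPf de].
  case eX : (e \in X); last by rewrite perm1 de eX.
  have -> : tperm (e, true) (e, false) d = (d.1, ~~ d.2).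
    by rewrite de; case: d de => _ [] /= ->; rewrite ?tpermL ?tpermR.
  by rewrite /= de (negPf es) andbF eX.
have -> : (if e \in X then tperm (e, true) (e, false) else 1)%g d = d.
  case: ifP => _; last exact: perm1.
  by rewrite tpermD //; apply/eqP => /(congr1 fst) /= /eqP; rewrite eq_sym de.
by [].
Qed.

Variable f : flag E -> flag E.
Hypothesis fK : involutive f.
Hypothesis fc : forall x, c (f x) = ~~ c x.

Lemma rot_fun_inj : injective (rot_fun f).
Proof.
move=> d d' E0; suff /(inv_inj fK) /(congr1 fst) : f (pos_flag d) = f (pos_flag d') by [].
by rewrite -[LHS]neg_flagK ?fc ?pos_flagT // -[RHS]neg_flagK ?fc ?pos_flagT // [(_).1]E0.
Qed.

Definition rot_perm : {perm dart} := perm rot_fun_inj.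

Section Boundary.

Variable X : {set E}.
Hypothesis c2 : forall x, edge_of x \in X -> c (a2 x) = ~~ c x.
Local Notation pi := (rot_perm * edge_swap X)%g.

Lemma beta_color x : c (beta X x) = ~~ c x.
Proof. by rewrite /beta; case: ifP => [/c2|]. Qed.

Lemma beta_neg_flag x : ~~ c x -> beta X x = pos_flag (edge_swap X x.1).
Proof.
move=> cx; rewrite -[LHS]pos_flagK; last by rewrite beta_color.
congr pos_flag; rewrite edge_swapE /beta /edge_of; case: ifP => _ //.
by case: x {cx} => [[]].
Qed.

Lemma pos_flag_pi d : pos_flag (pi d) = beta X (f (pos_flag d)).
Proof. by rewrite permM permE beta_neg_flag // fc pos_flagT. Qed.

(** Boundary curves alternate between positive and negative corners, so one step of the permutation
    follows an arc of [f] and then [beta X]. *)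
Lemma porbit_boundary d d' : (d' \in porbit pi d) =
  connect (rel2 f (beta X)) (pos_flag d) (pos_flag d').
Proof.
have sym := rel2_sym fK (betaK X).
apply/idP/idP => [/porbitP[k ->]|].
  elim: k => [|k IH]; first by rewrite perm1 connect0.
  rewrite expgSr permM pos_flag_pi; apply: connect_trans IH _.
  exact: connect_trans (connect_rel2l _ _ _) (connect_rel2r _ _ _).
(* Each flag is represented by the positive flag of its [f]-arc, which makes the set closed under
   both involutions. *)
pose A := [pred x | (if c x then x else f x).1 \in porbit pi d].
have closedA : closed (rel2 f (beta X)) A.
  apply: intro_closed => // x y /orP[] /eqP-> {y}; rewrite !inE.
    by rewrite fc; case: (c x); rewrite /= ?fK.
  rewrite beta_color; case: (boolP (c x)) => cx /=.
    have cf : c (f (beta X x)) by rewrite fc beta_color negbK.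
    have /(congr1 fst) /= pix : pos_flag (pi (f (beta X x)).1) = x.
      by rewrite pos_flag_pi pos_flagK // fK betaK.
    by move=> xd; rewrite porbit_sym -(porbit1 _ (f _).1) pix porbit_sym.
  have cf : c (f x) by rewrite fc.
  have /(congr1 fst) /= <- : pos_flag (pi (f x).1) = beta X x.
    by rewrite pos_flag_pi pos_flagK // fK.
  by move=> xd; rewrite porbit_sym porbit1 porbit_sym.
move=> conn; have := closed_connect closedA conn.
by rewrite !inE !pos_flagT porbit_id.
Qed.

End Boundary.

End Ends.

(** * Colourings of pseudo-orientable ribbon graphs *)

Lemma n_comp_eq1P (T : finType) (e : rel T) (D : {set T}) x :
  connect_sym e -> closed e D -> x \in D ->
  reflect {in D, forall y, connect e x y} (n_comp e D == 1)%N.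
Proof.
move=> es Dc xD; apply: (iffP eqP) => [n1 y yD|conn].
  have rootD z : z \in D -> fingraph.root e z \in [predI roots e & D].
    move=> zD; apply/andP; split; first exact: roots_root.
    by rewrite /= -(closed_connect Dc (connect_root e z)).
  rewrite -root_connect //.
  have /card_le1_eqP le1 : (#|[predI roots e & D]| <= 1)%N by rewrite -[X in (_ <= X)%N]n1.
  by apply/eqP/le1; apply: rootD.
rewrite -(n_comp_connect es x); apply: eq_n_comp_r => y.
apply/idP/idP => [/conn//|xy]; by rewrite -(closed_connect Dc xy).
Qed.

(** * Orientability of the loops of a bouquet, read off from a colouring *)

Section LoopColor.

Variables (E : finType) (b1 : flag E -> flag E) (D : {set flag E}) (c : flag E -> bool).
Hypotheses (b1K : involutive b1).
Hypotheses (c0 : forall x, c (a0 x) = ~~ c x) (c1 : forall x, c (b1 x) = ~~ c x).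
Hypotheses (D0 : forall x, (a0 x \in D) = (x \in D)) (D1 : forall x, (b1 x \in D) = (x \in D)).
Hypotheses (D2 : forall x, (a2 x \in D) = (x \in D)).
Hypothesis bouquet : nverts b1 D = 1%N.

Let conn_vertex : {in D &, forall x y, connect (rel2 (@a0 E) b1) x y}.
Proof.
move=> x y xD yD; have Dc : closed (rel2 (@a0 E) b1) D.
  by move=> z w /orP[] /eqP->; rewrite ?D0 ?D1.
apply: (n_comp_eq1P _ Dc xD) => //; first exact: rel2_sym (@a0K E) b1K.
exact/eqP.
Qed.

Variable x : flag E.
Hypothesis xD : x \in D.
Let e := edge_of x.
Let B : pred (flag E) := fun z => edge_of z == e.

Let bdryC : connect (rel2 b1 (beta [set e])) =2 connect (rel2 (beta [set e]) b1).
Proof. exact: connect_rel2C. Qed.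

Let bdry_sym : connect_sym (rel2 b1 (beta [set e])).
Proof. exact: rel2_sym b1K (betaK _). Qed.

Let bdryD : closed (rel2 b1 (beta [set e])) D.
Proof. by move=> z w /orP[] /eqP->; rewrite ?D1 // /beta; case: ifP; rewrite ?D0 ?D2. Qed.

Let beta_off z : ~~ B z -> beta [set e] z = a0 z.
Proof. by rewrite /B /beta inE => /negPf->. Qed.

Let beta_on z : B z -> beta [set e] z = a2 z.
Proof. by rewrite /B /beta inE => ->. Qed.

(** Attaching the loop replaces two colour-respecting arcs of the vertex circle by arcs joining
    equal colours; by [crossing_coarser] the circle stays in one piece. *)
Lemma twisted_loop : c (a2 x) = c x -> nbdry b1 [set e] D = 1%N.
Proof.
move=> cx; apply/eqP/(n_comp_eq1P bdry_sym bdryD xD) => y yD; rewrite bdryC.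
apply: (@crossing_coarser E (@a0 E) b1 c B _ _ _ _ _ x (a2 x)) => //.
- exact: a0K.
- by move=> z /eqP/edge_flags.
- exact: betaK.
- by rewrite beta_on /B ?eqxx.
- by rewrite beta_on // /B eqxx.
- exact: conn_vertex.
Qed.

(** Every flag of [D] lies on the boundary component of [x] or of [a0 x]. If these coincided, the
    boundary permutations for the empty set and for [[set e]] would have the same cycles, yet they
    differ by one transposition and hence in parity. *)
Lemma untwisted_loop : c (a2 x) = ~~ c x -> nbdry b1 [set e] D = 2%N.
Proof.
move=> cx.
have c2 z : edge_of z \in [set e] -> c (a2 z) = ~~ c z.
  rewrite inE => /eqP/edge_flags; rewrite !inE => /or4P[] /eqP->;
    by rewrite ?a2K -?a0a2 ?a2K ?c0 ?cx ?negbK.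
have cover z : z \in D -> connect (rel2 b1 (beta [set e])) x z \/
    connect (rel2 b1 (beta [set e])) (a0 x) z.
  move=> zD.
  pose A := [pred w | connect (rel2 b1 (beta [set e])) x w ||
                      connect (rel2 b1 (beta [set e])) (a0 x) w].
  suff: z \in A by move/orP.
  have Ac : closed (rel2 (@a0 E) b1) A.
    apply: intro_closed; first exact: rel2_sym (@a0K E) b1K.
    have step (h : flag E -> flag E) w : connect (rel2 b1 (beta [set e])) w (h w) ->
        w \in A -> h w \in A.
      by move=> wh /orP[] ?; apply/orP; [left|right]; apply: connect_trans wh.
    move=> w y /orP[] /eqP-> {y}; last by apply: step; apply: connect_rel2l.
    case: (boolP (B w)) => [Bw _|nB]; last first.
      by apply: step; rewrite -beta_off //; apply: connect_rel2r.
    have xx : connect (rel2 b1 (beta [set e])) x (a2 x).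
      by have := connect_rel2r b1 (beta [set e]) x; rewrite beta_on // /B.
    have xx0 : connect (rel2 b1 (beta [set e])) (a0 x) (a0 (a2 x)).
      by have := connect_rel2r b1 (beta [set e]) (a0 x); rewrite beta_on // /B.
    move/eqP/edge_flags: Bw; rewrite !inE => /or4P[] /eqP->;
      by rewrite ?a0K ?connect0 ?xx ?xx0 ?orbT.
  by rewrite -(closed_connect Ac (conn_vertex xD zD)) inE connect0.
suff sep : ~~ connect (rel2 b1 (beta [set e])) x (a0 x).
  rewrite /nbdry /norbits (@eq_n_comp_r _ _ _ (closure (rel2 b1 (beta [set e])) (pred2 x (a0 x)))).
    by rewrite n_comp_closure2 // sep.
  move=> z; apply/idP/idP => [zD|].
    case: (cover z zD); rewrite bdry_sym => xz; apply/pred0Pn.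
      by exists x; rewrite !inE eqxx /= andbT.
    by exists (a0 x); rewrite !inE eqxx orbT /= andbT.
  case/pred0Pn => w /andP[/= zw].
  rewrite (closed_connect bdryD zw).
  by case/pred2P => ->; rewrite ?D0.
apply/negP => joined.
have conn1 : {in D &, forall y z, connect (rel2 b1 (beta [set e])) y z}.
  have fromx z : z \in D -> connect (rel2 b1 (beta [set e])) x z.
    by case/cover => // /(connect_trans joined).
  move=> y z /fromx yx /fromx; apply: connect_trans; by rewrite bdry_sym.
pose s0 := (rot_perm c0 b1K c1 * edge_swap set0)%g.
pose s1 := (rot_perm c0 b1K c1 * edge_swap [set e])%g.
have set0_c2 z : edge_of z \in set0 -> c (a2 z) = ~~ c z by rewrite inE.
have b0 : beta set0 =1 @a0 E by move=> z; rewrite /beta inE.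
have conn0 : {in D &, forall y z, connect (rel2 b1 (beta set0)) y z}.
  move=> y z yD zD; rewrite connect_rel2C -(@eq_connect _ (rel2 (@a0 E) b1)) ?conn_vertex //.
  by move=> u w; rewrite /rel2 b0.
(* The loop is not met outside [D], so the two permutations agree there. *)
have s01 d : pos_flag c d \notin D -> s1 d = s0 d /\ pos_flag c (s0 d) \notin D.
  move=> dD; have bD : b1 (pos_flag c d) \notin D by rewrite D1.
  split.
    rewrite !permM !edge_swapE !inE /=; case: eqP => // ed.
    case/negP: bD; have /edge_flags : edge_of (b1 (pos_flag c d)) = edge_of x.
      by rewrite -/e -ed permE.
    by rewrite !inE => /or4P[] /eqP->; rewrite ?D0 ?D2 ?D0 ?D2.
  by rewrite pos_flag_pi // b0 D0.
have eq_porb d : porbit s1 d = porbit s0 d.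
  apply/setP => d'; case: (boolP (pos_flag c d \in D)) => dD.
    rewrite !porbit_boundary //.
    case: (boolP (pos_flag c d' \in D)) => d'D; first by rewrite conn0 // conn1.
    have cl0 : closed (rel2 b1 (beta set0)) D.
      by move=> z w /orP[] /eqP->; rewrite ?D1 // b0 D0.
    apply/idP/idP => [/(closed_connect bdryD)|/(closed_connect cl0)]; by rewrite dD (negPf d'D).
  have iter_eq k : (s1 ^+ k)%g d = (s0 ^+ k)%g d /\ pos_flag c ((s0 ^+ k)%g d) \notin D.
    elim: k => [|k [IH1 IH2]]; first by rewrite !perm1.
    by rewrite !expgSr [(_ * s1)%g d]permM [(_ * s0)%g d]permM IH1; apply: s01.
  by apply/porbitP/porbitP => -[k ->]; exists k; case: (iter_eq k).
have : odd_perm s1 = odd_perm s0.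
  rewrite /odd_perm; congr (_ (+) odd #|pred_of_set _|); exact: eq_imset.
have sw0 : edge_swap (set0 : {set E}) = 1%g.
  by apply/permP => d; rewrite edge_swapE inE perm1.
have sw1 : edge_swap [set e] = tperm (e, true) (e, false).
  apply/permP => -[e' t]; rewrite edge_swapE inE /=.
  case: tpermP => [[-> ->]|[-> ->]|/eqP n1 /eqP n2]; rewrite ?eqxx //.
  by case: eqP => // ee; move: n1 n2; rewrite ee !xpair_eqE eqxx; case: t.
rewrite /s1 /s0 sw0 sw1 !odd_permM odd_tperm odd_perm1 xpair_eqE andbF /=.
by case: (odd_perm _).
Qed.

Lemma orientable_loop_color : orientable_loop_in b1 D e <-> c (a2 x) = ~~ c x.
Proof.
split=> [o|/untwisted_loop//]; case: (c (a2 x) =P c x) => [/twisted_loop|].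
  by move: o; rewrite /orientable_loop_in => ->.
by case: (c (a2 x)); case: (c x).
Qed.

End LoopColor.

Section Psi.

Variable E : finType.
Implicit Types (X : {set E}) (x : flag E).

Lemma edge_psi X x : edge_of (psi X x) = edge_of x.
Proof. by rewrite /psi; case: ifP. Qed.

Lemma psiK X : involutive (psi X).
Proof.
by case=> [[e s] t]; rewrite /psi /edge_of /=; case eX : (e \in X); rewrite /= eX.
Qed.

Lemma psi_a0 X x : psi X (a0 x) = if edge_of x \in X then a2 (psi X x) else a0 (psi X x).
Proof. by rewrite /psi (_ : edge_of (a0 x) = edge_of x) //; case: ifP. Qed.

Lemma psi_a2 X x : psi X (a2 x) = if edge_of x \in X then a0 (psi X x) else a2 (psi X x).
Proof. by rewrite /psi (_ : edge_of (a2 x) = edge_of x) //; case: ifP. Qed.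

End Psi.

Section Component.

Variables (E : finType) (a1 : flag E -> flag E).
Hypothesis a1K : involutive a1.
Implicit Types x y : flag E.

Lemma conn_rel_sym : connect_sym (conn_rel a1).
Proof.
apply: sym_connect_sym => x y; rewrite /conn_rel.
by rewrite -(can_eq (@a0K E) y) a0K -(can_eq a1K y (a1 x)) a1K -(can_eq (@a2K E) y (a2 x)) a2K
  eq_sym [a1 y == x]eq_sym [a2 y == x]eq_sym.
Qed.

Lemma conn_a0 x : connect (conn_rel a1) x (a0 x).
Proof. by apply: connect1; rewrite /conn_rel eqxx. Qed.

Lemma conn_a1 x : connect (conn_rel a1) x (a1 x).
Proof. by apply: connect1; rewrite /conn_rel eqxx orbT. Qed.

Lemma conn_a2 x : connect (conn_rel a1) x (a2 x).
Proof. by apply: connect1; rewrite /conn_rel eqxx !orbT. Qed.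

Lemma mem_comp x y : (y \in Defs.comp a1 x) = connect (conn_rel a1) x y.
Proof. by rewrite inE. Qed.

Lemma comp_closed x y z : connect (conn_rel a1) y z ->
  (z \in Defs.comp a1 x) = (y \in Defs.comp a1 x).
Proof. by move=> yz; rewrite !mem_comp (same_connect_r conn_rel_sym yz). Qed.

Lemma comp_edge x y z : edge_of z = edge_of y ->
  (z \in Defs.comp a1 x) = (y \in Defs.comp a1 x).
Proof.
move/edge_flags; rewrite !inE => /or4P[] /eqP-> //; apply: (same_connect_r conn_rel_sym);
  rewrite conn_rel_sym ?conn_a0 ?conn_a2 //.
exact: connect_trans (conn_a2 _) (conn_a0 _).
Qed.

End Component.

(** An alternating colouring of the vertex circle of the dual bouquet is flipped on [S]. By
    [orientable_loop_color] every loop then switches colours along its long sides, and only arcs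
    between [S] and its complement can fail. On [X0], [psi X0] exchanges [a0] and [a2], which both
    switch colours, so the colouring carries over to [G]. *)
Lemma ps_or_conn_coloring (E : finType) (G : ribbon_graph E) x0 :
  ribbon_ok G -> let D := Defs.comp (rg_a1 G) x0 in ps_or_conn_in G D ->
  exists c : flag E -> bool,
    {in D, forall x, c (a0 x) = ~~ c x /\ c (a2 x) = ~~ c x} /\
    (#|[set x in D | c (rg_a1 G x) == c x]| <= 4)%N.
Proof.
move=> [a1K a1x] D [X0 [_ [one_vertex [S [SD S0 SW loops]]]]].
pose b1 := rg_a1 (pdual G X0).
have b1E x : b1 x = psi X0 (rg_a1 G (psi X0 x)) by [].
rewrite -/b1 in SW loops one_vertex.
have psiD x : (psi X0 x \in D) = (x \in D) by apply: comp_edge; rewrite ?edge_psi.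
have D0 x : (a0 x \in D) = (x \in D) by apply/comp_closed/conn_a0.
have D2 x : (a2 x \in D) = (x \in D) by apply/comp_closed/conn_a2.
have D1 x : (b1 x \in D) = (x \in D).
  by rewrite b1E psiD -[RHS]psiD; apply/comp_closed/conn_a1.
have b1K : involutive b1 by move=> x; rewrite !b1E psiK a1K psiK.
have b1x x : b1 x != x.
  rewrite b1E; apply/eqP => /(congr1 (psi X0)); rewrite psiK => /eqP.
  exact/negP/a1x.
have [c' [c0 c1]] := involutions_two_colorable (@a0K E) b1K (@a0_neq E) b1x.
pose cS x := c' x (+) (x \in S).
have cS0 x : cS (a0 x) = ~~ cS x by rewrite /cS c0 S0 addNb.
have cS2 x : x \in D -> cS (a2 x) = ~~ cS x.
  move=> xD; have := loops x xD.
  rewrite (orientable_loop_color b1K c0 c1 D0 D1 D2 one_vertex xD) /cS.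
  by case: (c' (a2 x)); case: (c' x); case: (x \in S); case: (a2 x \in S) => //= -[] h1 h2;
     first [by case: (h1 erefl) | by case: (h2 erefl)].
exists (cS \o psi X0); split=> [x xD|] /=.
  have pD : psi X0 x \in D by rewrite psiD.
  by rewrite psi_a0 psi_a2; case: ifP => _; rewrite cS0 cS2.
(* Each of the at most two arcs leaving [S] accounts for two bad flags, whence the bound 4. *)
pose W := [set x in S | b1 x \notin S].
have sub : [set x in D | cS (psi X0 (rg_a1 G x)) == cS (psi X0 x)] \subset
    psi X0 @: (W :|: b1 @: W).
  apply/subsetP => x; rewrite inE => /andP[xD bad]; apply/imsetP.
  exists (psi X0 x); last by rewrite psiK.
  have : (b1 (psi X0 x) \in S) != (psi X0 x \in S).
    move: bad; rewrite -[x in rg_a1 G x](psiK X0) -b1E /cS c1.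
    by case: (c' _); case: (_ \in S); case: (_ \in S).
  rewrite inE; case: (boolP (psi X0 x \in S)) => xS bS.
    by rewrite inE xS; move: bS; case: (b1 _ \in S).
  apply/orP; right; apply/imsetP; exists (b1 (psi X0 x)); last by rewrite b1K.
  by rewrite inE b1K xS; move: bS; case: (b1 _ \in S).
apply: leq_trans (subset_leq_card sub) _.
apply: leq_trans (leq_imset_card _ _) _.
rewrite cardsU; have := leq_imset_card b1 W; rewrite -/W in SW; lia.
Qed.

Section GlobalColoring.

Variables (E : finType) (a1 : flag E -> flag E).
Hypotheses (a1K : involutive a1) (a1_neq : forall x, a1 x != x).

(** Outside [D] each flag uses the orientation chosen at the root of its component. The formula for
    [a1] on [D] records that [c] fails to switch exactly where [cD] does. *)
Lemma glue_colorings (D : {set flag E}) (cD : flag E -> bool) :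
  (forall x y, connect (conn_rel a1) x y -> (x \in D) = (y \in D)) ->
  {in D, forall x, cD (a0 x) = ~~ cD x /\ cD (a2 x) = ~~ cD x} ->
  (forall y, y \notin D -> orientable_in a1 (Defs.comp a1 y)) ->
  exists c, [/\ forall x, c (a0 x) = ~~ c x, forall x, c (a2 x) = ~~ c x &
    forall x, c (a1 x) = if x \in D then cD (a1 x) (+) cD x (+) c x else ~~ c x].
Proof.
move=> Dc cDP orient.
have [col colP] : exists col : flag E -> flag E -> bool, forall y, y \notin D ->
    forall x, x \in Defs.comp a1 y ->
    [&& col y (a0 x) != col y x, col y (a1 x) != col y x & col y (a2 x) != col y x].
  apply: (@fin_all_exists _ (fun=> flag E -> bool)
    (fun y (cy : flag E -> bool) => y \notin D -> forall x, x \in Defs.comp a1 y ->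
      [&& cy (a0 x) != cy x, cy (a1 x) != cy x & cy (a2 x) != cy x])) => y.
  case: (boolP (y \in D)) => yD; first by exists xpredT.
  by have [cy cyP] := orient y yD; exists cy.
pose rt := fingraph.root (conn_rel a1).
have sym := conn_rel_sym a1K.
have rtE x y : connect (conn_rel a1) x y -> rt y = rt x by move/(fingraph.rootP sym).
exists (fun x => if x \in D then cD x else col (rt x) x).
have out x : x \notin D -> [/\ col (rt x) (a0 x) = ~~ col (rt x) x,
    col (rt x) (a1 x) = ~~ col (rt x) x & col (rt x) (a2 x) = ~~ col (rt x) x].
  move=> xD; have := colP (rt x); rewrite -(Dc _ _ (connect_root _ x)) => /(_ xD x).
  rewrite mem_comp sym connect_root => /(_ isT).
  by case/and3P; do 4! [case: (col _ _)].
split=> x.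
- rewrite -(Dc _ _ (conn_a0 a1 x)) (rtE _ _ (conn_a0 a1 x)); case: (boolP (x \in D)) => xD.
    by case: (cDP x xD).
  by case: (out x xD).
- rewrite -(Dc _ _ (conn_a2 a1 x)) (rtE _ _ (conn_a2 a1 x)); case: (boolP (x \in D)) => xD.
    by case: (cDP x xD).
  by case: (out x xD).
- rewrite -(Dc _ _ (conn_a1 a1 x)) (rtE _ _ (conn_a1 a1 x)); case: (boolP (x \in D)) => xD.
    by rewrite addbK.
  by case: (out x xD).
Qed.

(* a0 matches the two colours perfectly and a1 matches all flags but the monochromatic ones, so
   there are as many monochromatic flags of each colour. *)
Lemma few_bad_arcs (c : flag E -> bool) : (forall x, c (a0 x) = ~~ c x) ->
  (#|[set x | c (a1 x) == c x]| <= 4)%N ->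
  (forall x, c (a1 x) = ~~ c x) \/
  exists x1 x2, [/\ c x1, c (a1 x1), ~~ c x2, ~~ c (a1 x2) &
    forall z, c (a1 z) = c z -> z \in [:: x1; a1 x1; x2; a1 x2]].
Proof.
move=> c0 bad4.
pose bad b := [set x | (c x == b) && (c (a1 x) == b)].
pose good b := [set x | (c x == b) && (c (a1 x) != b)].
have split_color b : #|[set x | c x == b]| = (#|bad b| + #|good b|)%N.
  rewrite -(cardsID [set x | c (a1 x) == b]); congr (_ + _)%N; apply: eq_card => x; rewrite !inE //.
  by rewrite andbC.
have eq_color : #|[set x | c x == true]| = #|[set x | c x == false]|.
  rewrite -(card_imset _ (inv_inj (@a0K E))); apply: eq_card => x.
  apply/imsetP/idP => [[y]|]; rewrite !inE => cx.
    by move=> ->; rewrite c0 (eqP cx).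
  by exists (a0 x); rewrite ?a0K // inE c0 (eqP cx).
have eq_good : #|good true| = #|good false|.
  rewrite -(card_imset _ (inv_inj a1K)); apply: eq_card => x.
  apply/imsetP/idP => [[y]|]; rewrite !inE => /andP[cx c1x].
    by move=> ->; rewrite a1K (eqP cx); move: c1x; case: (c (a1 y)).
  exists (a1 x); rewrite ?a1K // inE a1K (eqP cx); move: c1x; by case: (c (a1 x)).
have eq_bad : #|bad true| = #|bad false|.
  have := split_color true; have := split_color false; lia.
have bad_sum : #|[set x | c (a1 x) == c x]| = (#|bad true| + #|bad false|)%N.
  rewrite -(cardsID [set x | c x == true]); congr (_ + _)%N; apply: eq_card => x; rewrite !inE.
    by case: (c x); case: (c (a1 x)).
  by case: (c x); case: (c (a1 x)).
have bad2 b : (#|bad b| <= 2)%N by case: b; lia.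
(* A colour has at most two bad flags, so [x] and [a1 x] are all of them. *)
have pair b x : x \in bad b -> forall z, z \in bad b -> z = x \/ z = a1 x.
  move=> xb z zb.
  have a1b : a1 x \in bad b by move: xb; rewrite !inE a1K andbC.
  have sub : [set x; a1 x] \subset bad b by rewrite subUset !sub1set xb.
  have /eqP E0 : [set x; a1 x] == bad b.
    by rewrite eqEcard sub cards2 [x == _]eq_sym a1_neq bad2.
  by move: zb; rewrite -E0 !inE => /orP[] /eqP; auto.
case: (set_0Vmem (bad true)) => [b0|[x1 x1b]].
  have b0' : #|bad true| = 0%N by rewrite b0 cards0.
  left=> x; have : x \notin [set x | c (a1 x) == c x].
    by rewrite (cards0_eq (etrans bad_sum _)) ?inE // -eq_bad b0'.
  by rewrite inE; case: (c x); case: (c (a1 x)).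
have /card_gt0P[x2 x2b] : (0 < #|bad false|)%N by rewrite -eq_bad; apply/card_gt0P; exists x1.
right; exists x1, x2; move: (x1b) (x2b); rewrite !inE => /andP[/eqP-> /eqP->] /andP[/eqP-> /eqP->].
split=> // z cz; case cz' : (c z).
  by have [|->|->] := pair _ _ x1b z; rewrite ?inE ?cz ?cz' ?eqxx ?orbT.
by have [|->|->] := pair _ _ x2b z; rewrite ?inE ?cz ?cz' ?eqxx ?orbT.
Qed.

End GlobalColoring.

Lemma pseudo_orientable_coloring (E : finType) (G : ribbon_graph E) :
  let a1 := rg_a1 G in ribbon_ok G -> pseudo_orientable G ->
  exists c : flag E -> bool, [/\ forall x, c (a0 x) = ~~ c x, forall x, c (a2 x) = ~~ c x &
    (forall x, c (a1 x) = ~~ c x) \/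
    exists x1 x2, connect (conn_rel a1) x1 x2 /\
      [/\ c x1, c (a1 x1), ~~ c x2, ~~ c (a1 x2) &
        forall z, c (a1 z) = c z -> z \in [:: x1; a1 x1; x2; a1 x2]]].
Proof.
move=> a1 ok; have [a1K a1x] := ok; case=> [[x0 [ps orient]]|[_ orient]]; last first.
  (* When the special component is an isolated vertex, all flags lie in orientable components, hence
     the empty [D]. *)
  have [||c [c0 c2 c1]] := @glue_colorings _ _ a1K set0 xpredT _ _ (fun y _ => orient y).
  - by move=> x y _; rewrite !inE.
  - by move=> x; rewrite inE.
  by exists c; split=> //; left=> x; rewrite c1 inE.
have [cD [cDP cD4]] := ps_or_conn_coloring ok ps.
set D := Defs.comp _ x0 in cDP cD4 orient.
have [||c [c0 c2 c1]] := @glue_colorings _ _ a1K D cD _ _ orient => //.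
  by move=> x y xy; rewrite (comp_closed a1K x0 xy).
have badD z : c (a1 z) = c z -> z \in D.
  by rewrite c1; case: ifP => // _; case: (c z).
exists c; split=> //.
have bad4 : (#|[set x | c (a1 x) == c x]| <= 4)%N.
  apply: leq_trans cD4; apply/subset_leq_card/subsetP => x; rewrite inE => /eqP cx.
  have xD := badD x cx; rewrite inE xD; move: cx; rewrite c1 xD /a1.
  by case: (cD _); case: (cD x); case: (c x).
have [|[x1 [x2 H]]] := few_bad_arcs a1K a1x c0 bad4; first by left.
right; exists x1, x2; split=> //.
have [h1 h2 h3 h4 _] := H.
have x1D : x1 \in D by apply: badD; rewrite h1 h2.
have x2D : x2 \in D by apply: badD; rewrite (negPf h3) (negPf h4).
move: x1D x2D; rewrite !mem_comp (conn_rel_sym a1K); exact: connect_trans.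
Qed.

(** * Quasi-trees *)

Lemma ulc_ext (a a' : nat -> nat) : a =1 a' ->
  ultra_log_concave a' /\ no_internal_zeros a' -> ultra_log_concave a /\ no_internal_zeros a.
Proof.
move=> aE [ulc niz]; have sb l u : support_bounds a l u -> support_bounds a' l u.
  by case=> al au bnd; split; rewrite -?aE // => i; rewrite -aE; apply: bnd.
split=> l u /sb H i; rewrite ?aE; first exact: ulc H i.
exact: niz H i.
Qed.

Section BoundaryClasses.

Variables (E : finType) (a1 : flag E -> flag E) (c : flag E -> bool).
Hypotheses (a1K : involutive a1).
Hypotheses (c0 : forall x, c (a0 x) = ~~ c x) (c2 : forall x, c (a2 x) = ~~ c x).
Implicit Types (f : flag E -> flag E) (X : {set E}).

(** One boundary curve per component, stated without counting and for any reconnection [f], while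
    the components remain those of [a1]. *)
Definition bdry_connected f X : Prop :=
  forall x y, connect (conn_rel a1) x y -> connect (rel2 f (beta X)) x y.

Definition dart_comp (d : E * bool) : flag E := fingraph.root (conn_rel a1) (pos_flag c d).

Lemma dart_compP d d' :
  reflect (dart_comp d = dart_comp d') (connect (conn_rel a1) (pos_flag c d) (pos_flag c d')).
Proof. by apply: fingraph.rootP; apply: conn_rel_sym. Qed.

Lemma dart_comp_edge e s t : dart_comp (e, s) = dart_comp (e, t).
Proof.
apply/dart_compP.
by rewrite -mem_comp (@comp_edge _ _ a1K _ (pos_flag c (e, s))) // mem_comp connect0.
Qed.

Variable f : flag E -> flag E.
Hypotheses (fK : involutive f) (fc : forall x, c (f x) = ~~ c x).
Hypothesis f_conn : forall x, connect (conn_rel a1) x (f x).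

Lemma dart_comp_rot d : dart_comp (rot_perm c0 fK fc d) = dart_comp d.
Proof.
apply/esym/dart_compP; rewrite permE.
have -> : pos_flag c (rot_fun c f d) = a0 (f (pos_flag c d)).
  by rewrite -[f _ in RHS](neg_flagK c0) ?a0K // fc pos_flagT.
exact: connect_trans (f_conn _) (conn_a0 _ _).
Qed.

Lemma class_transitive_bdry X : reflect (bdry_connected f X)
  (class_transitive dart_comp (rot_perm c0 fK fc * edge_swap X)%g).
Proof.
have c2X x : edge_of x \in X -> c (a2 x) = ~~ c x by move=> _; apply: c2.
have symB := rel2_sym fK (betaK X); have symC := conn_rel_sym a1K.
apply: (iffP idP) => [/forallP tr x y xy|bc].
  (* Every flag shares its curve and its component with a positive corner. *)
  have pos z : exists d, connect (rel2 f (beta X)) z (pos_flag c d) /\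
      connect (conn_rel a1) z (pos_flag c d).
    case: (boolP (c z)) => cz; first by exists z.1; rewrite pos_flagK.
    by exists (f z).1; rewrite pos_flagK ?fc //; split=> //; apply: connect_rel2l.
  have [d [xd xd']] := pos x; have [d' [yd yd']] := pos y.
  have /forallP/(_ d')/implyP := tr d; rewrite porbit_boundary //.
  have -> : dart_comp d == dart_comp d'.
    apply/eqP/dart_compP; rewrite symC in xd'.
    exact: connect_trans xd' (connect_trans xy yd').
  move=> /(_ isT) dd'; rewrite symB in yd.
  exact: connect_trans xd (connect_trans dd' yd).
apply/forallP => d; apply/forallP => d'; apply/implyP => /eqP/dart_compP dd'.
by rewrite porbit_boundary //; apply: bc.
Qed.

End BoundaryClasses.

Lemma quasi_treeP (E : finType) (G : ribbon_graph E) X : ribbon_ok G ->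
  reflect (bdry_connected (rg_a1 G) (rg_a1 G) X) (quasi_tree G X).
Proof.
case=> a1K _; have sym := rel2_sym a1K (betaK X).
have closedD x : closed (rel2 (rg_a1 G) (beta X)) (Defs.comp (rg_a1 G) x).
  move=> y z /orP[] /eqP->; apply/esym/(comp_closed a1K); first exact: conn_a1.
  by rewrite /beta; case: ifP => _; [apply: conn_a2 | apply: conn_a0].
have self x : x \in Defs.comp (rg_a1 G) x by rewrite mem_comp connect0.
apply: (iffP forallP) => [qt x y xy|bc x].
  by apply: (n_comp_eq1P sym (closedD x) (self x) (qt x)); rewrite mem_comp.
by apply/(n_comp_eq1P sym (closedD x) (self x)) => y; rewrite mem_comp; apply: bc.
Qed.

Lemma orientable_ulc (E : finType) (G : ribbon_graph E) (Q : {set E}) (c : flag E -> bool) :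
  ribbon_ok G -> (forall x, c (a0 x) = ~~ c x) -> (forall x, c (a2 x) = ~~ c x) ->
  (forall x, c (rg_a1 G x) = ~~ c x) ->
  ultra_log_concave (qseq G Q) /\ no_internal_zeros (qseq G Q).
Proof.
move=> ok c0 c2 c1; have [a1K _] := ok.
pose rho := rot_perm c0 a1K c1.
have swE X : switch_perm (enum E) (fun e => (e, true)) (fun e => (e, false)) (fun=> 1%g) rho X
    = (rho * edge_swap X)%g.
  by rewrite /switch_perm /edge_swap; congr (_ * _)%g; apply: eq_bigr => e _; rewrite mulg1.
have := @switch_ulc (E * bool)%type E (enum E) (fun e => (e, true)) (fun e => (e, false))
  (fun=> 1%g) rho _ (dart_comp (rg_a1 G) c) (enum_uniq _) (mem_enum E) _ _ _ _ Q.
move=> H; apply: ulc_ext (H _ _ _ _).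
- move=> i; apply: eq_card => X; rewrite !inE swE; congr (_ && _).
  by apply/(quasi_treeP _ ok)/(class_transitive_bdry a1K c0 c2) => // x; apply: conn_a1.
- by move=> e; rewrite xpair_eqE andbF.
- by move=> e; apply: dart_comp_edge.
- by move=> e z; rewrite perm1.
- by move=> z; apply: dart_comp_rot => // x; apply: conn_a1.
Qed.

Section SwapArcs.

Variables (E : finType) (a1 : flag E -> flag E) (c : flag E -> bool) (x1 x2 : flag E).
Hypotheses (a1K : involutive a1) (a1_neq : forall x, a1 x != x).
Hypotheses (c1x1 : c (a1 x1) = c x1) (c1x2 : c (a1 x2) = c x2) (cx12 : c x2 = ~~ c x1).
Hypothesis good : forall z, c (a1 z) = c z -> z \in [:: x1; a1 x1; x2; a1 x2].
Hypothesis x12 : connect (conn_rel a1) x1 x2.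

(* Conjugating a1 by the transposition of (a1 x1) and x2 replaces the arcs {x1, a1 x1} and
   {x2, a1 x2} by {x1, x2} and {a1 x1, a1 x2}. *)
Definition swap_arcs (z : flag E) : flag E := tperm (a1 x1) x2 (a1 (tperm (a1 x1) x2 z)).

Lemma swap_arcsK : involutive swap_arcs.
Proof. by move=> z; rewrite /swap_arcs tpermK a1K tpermK. Qed.

Let neq_color z w : c z = c x1 -> c w = c x2 -> (z == w) = false.
Proof. by move=> cz cw; apply/eqP => zw; move: cz; rewrite zw cw cx12; case: (c x1). Qed.

Lemma swap_arcs_x1 : swap_arcs x1 = x2.
Proof. by rewrite /swap_arcs [tperm _ _ x1]tpermD ?tpermL // eq_sym neq_color. Qed.

Lemma swap_arcs_x2 : swap_arcs x2 = x1.
Proof. by rewrite -{1}swap_arcs_x1 swap_arcsK. Qed.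

Lemma swap_arcs_y1 : swap_arcs (a1 x1) = a1 x2.
Proof. by rewrite /swap_arcs tpermL tpermD // ?[x2 == _]eq_sym ?a1_neq // neq_color. Qed.

Lemma swap_arcs_y2 : swap_arcs (a1 x2) = a1 x1.
Proof. by rewrite -{1}swap_arcs_y1 swap_arcsK. Qed.

Lemma swap_arcs_off z : z \notin [:: x1; a1 x1; x2; a1 x2] -> swap_arcs z = a1 z.
Proof.
rewrite !inE !negb_or => /and4P[n1 n2 n3 n4].
rewrite /swap_arcs [tperm _ _ z]tpermD; try by rewrite eq_sym.
rewrite tpermD //; first by rewrite (inj_eq (inv_inj a1K)) eq_sym.
by rewrite -(inj_eq (inv_inj a1K)) a1K eq_sym.
Qed.

Lemma swap_arcs_color z : c (swap_arcs z) = ~~ c z.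
Proof.
case: (boolP (z \in [:: x1; a1 x1; x2; a1 x2])) => [|zB].
  rewrite !inE => /or4P[] /eqP->;
    by rewrite ?swap_arcs_x1 ?swap_arcs_y1 ?swap_arcs_x2 ?swap_arcs_y2 ?c1x1 ?c1x2 ?cx12 ?negbK.
rewrite swap_arcs_off //; case: (c (a1 z) =P c z) => [/good|]; first by rewrite (negPf zB).
by case: (c z); case: (c (a1 z)).
Qed.

Lemma swap_arcs_conn z : connect (conn_rel a1) z (swap_arcs z).
Proof.
have sym := conn_rel_sym a1K.
have y12 : connect (conn_rel a1) (a1 x1) (a1 x2).
  have y1 := conn_a1 a1 x1; rewrite sym in y1.
  exact: connect_trans y1 (connect_trans x12 (conn_a1 _ _)).
case: (boolP (z \in [:: x1; a1 x1; x2; a1 x2])) => [|zB]; last first.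
  by rewrite swap_arcs_off //; apply: conn_a1.
rewrite !inE => /or4P[] /eqP->;
  by rewrite ?swap_arcs_x1 ?swap_arcs_y1 ?swap_arcs_x2 ?swap_arcs_y2 // sym.
Qed.

End SwapArcs.

(** * The two reconnections, with the choice between them as an extra element *)

Section PseudoOrientable.

Variables (E : finType) (G : ribbon_graph E) (c : flag E -> bool) (x1 x2 : flag E).
Hypothesis ok : ribbon_ok G.
Local Notation a1 := (rg_a1 G).
Hypotheses (c0 : forall x, c (a0 x) = ~~ c x) (c2 : forall x, c (a2 x) = ~~ c x).
Hypothesis x12 : connect (conn_rel a1) x1 x2.
Hypotheses (cx1 : c x1) (cy1 : c (a1 x1)) (cx2 : ~~ c x2) (cy2 : ~~ c (a1 x2)).
Hypothesis good : forall z, c (a1 z) = c z -> z \in [:: x1; a1 x1; x2; a1 x2].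

Let a1K : involutive a1. Proof. by case: ok. Qed.
Let a1_neq x : a1 x != x. Proof. by case: ok. Qed.
Let y1E : c (a1 x1) = c x1. Proof. by rewrite cx1 cy1. Qed.
Let y2E : c (a1 x2) = c x2. Proof. by rewrite (negPf cx2) (negPf cy2). Qed.
Let y2E' : c (a1 (a1 x2)) = c (a1 x2). Proof. by rewrite a1K. Qed.
Let x2E : c x2 = ~~ c x1. Proof. by rewrite cx1 (negPf cx2). Qed.
Let y2x1 : c (a1 x2) = ~~ c x1. Proof. by rewrite cx1 (negPf cy2). Qed.
Let good' z : c (a1 z) = c z -> z \in [:: x1; a1 x1; a1 x2; a1 (a1 x2)].
Proof. by move/good; rewrite a1K !inE => /or4P[] ->; rewrite ?orbT. Qed.
Let bad_same z : (z \in [:: x1; a1 x1; a1 x2; a1 (a1 x2)]) = (z \in [:: x1; a1 x1; x2; a1 x2]).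
Proof. by rewrite a1K !inE [(z == a1 x2) || _]orbC. Qed.

Local Notation fA := (swap_arcs a1 x1 x2).
Local Notation fB := (swap_arcs a1 x1 (a1 x2)).

Let fAK : involutive fA := swap_arcsK x1 x2 a1K.
Let fBK : involutive fB := swap_arcsK x1 (a1 x2) a1K.
Let fAc := swap_arcs_color a1K a1_neq y1E y2E x2E good.
Let fBc := swap_arcs_color a1K a1_neq y1E y2E' y2x1 good'.

Let fA1 : fA x1 = x2. Proof. exact: (swap_arcs_x1 (c := c)). Qed.
Let fA2 : fA (a1 x1) = a1 x2. Proof. exact: (swap_arcs_y1 (c := c)). Qed.
Let fB1 : fB x1 = a1 x2. Proof. exact: (swap_arcs_x1 (c := c)). Qed.
Let fB2 : fB (a1 x1) = x2. Proof. by rewrite -[RHS]a1K; apply: (swap_arcs_y1 (c := c)). Qed.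
Let fA3 : fA x2 = x1. Proof. exact: canLR fAK (esym fA1). Qed.
Let fA4 : fA (a1 x2) = a1 x1. Proof. exact: canLR fAK (esym fA2). Qed.
Let fB3 : fB (a1 x2) = x1. Proof. exact: canLR fBK (esym fB1). Qed.
Let fB4 : fB x2 = a1 x1. Proof. exact: canLR fBK (esym fB2). Qed.

Let rotA := rot_perm c0 fAK fAc.
Let rotB := rot_perm c0 fBK fBc.

(** Both [x1] and [a1 x1] are positive corners, and on positive corners [fA] and [fB] differ only by
    exchanging the images of these two. *)
Lemma rot_swap_arcs : rotB = (tperm x1.1 (a1 x1).1 * rotA)%g.
Proof.
apply/permP => d; rewrite permM [LHS]permE [RHS]permE /rot_fun.
case: tpermP => [->|->|d1 d2].
- by rewrite !pos_flagK // fB1 fA2.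
- by rewrite !pos_flagK // fB2 fA1.
have dB : pos_flag c d \notin [:: x1; a1 x1; x2; a1 x2].
  have cd := pos_flagT c0 d.
  rewrite !inE !negb_or; apply/and4P; split; apply/eqP => E0.
  - by case: d1; rewrite -E0.
  - by case: d2; rewrite -E0.
  - by move: cx2; rewrite -E0 cd.
  - by move: cy2; rewrite -E0 cd.
by rewrite !swap_arcs_off // bad_same.
Qed.

(** Relative to [fA], the involution [a1] is the reconnection joining equal colours, and [fB] is the
    other one respecting them. *)
Lemma pseudo_bdry_connected X : bdry_connected a1 a1 X <->
  bdry_connected a1 fA X \/ bdry_connected a1 fB X.
Proof.
pose bad : pred (flag E) := fun z => z \in [:: x1; a1 x1; x2; a1 x2].
have bc x : c (beta X x) = ~~ c x by rewrite /beta; case: ifP.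
have fA_off z : ~~ bad z -> fA z = a1 z by apply: swap_arcs_off.
have fB_off z : ~~ bad z -> fB z = a1 z by move=> zb; apply: swap_arcs_off; rewrite // bad_same.
have bad_stable h : involutive h -> (forall z, bad z -> bad (h z)) -> forall z, bad (h z) = bad z.
  by move=> hK hb z; apply/idP/idP => [/hb|/hb//]; rewrite hK.
have badA : forall z, bad (fA z) = bad z.
  apply: bad_stable => // z; rewrite /bad !inE => /or4P[] /eqP->;
    by rewrite ?fA1 ?fA2 ?fA3 ?fA4 ?eqxx ?orbT.
have badB : forall z, bad (fB z) = bad z.
  apply: bad_stable => // z; rewrite /bad !inE => /or4P[] /eqP->;
    by rewrite ?fB1 ?fB2 ?fB3 ?fB4 ?eqxx ?orbT.
have subA : subrel (connect (rel2 fA (beta X))) (connect (rel2 a1 (beta X))).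
  apply: (@crossing_coarser E fA (beta X) c bad fAK (betaK X) fAc bc badA x1 (a1 x1)) => //.
  - by move=> z; rewrite fA1 fA2 /bad !inE => /or4P[] ->; rewrite ?orbT.
  - by move=> z /fA_off.
  - by rewrite fA1 fA2.
have subB : subrel (connect (rel2 fB (beta X))) (connect (rel2 a1 (beta X))).
  apply: (@crossing_coarser E fB (beta X) c bad fBK (betaK X) fBc bc badB x1 (a1 x1)) => //.
  - by move=> z; rewrite fB1 fB2 /bad !inE => /or4P[] ->; rewrite ?orbT.
  - by move=> z /fB_off.
  - by rewrite fB1 fB2 a1K.
split=> [b1|[b1|b1] x y /b1]; [|exact: subA|exact: subB].
have [] := @crossing_resolution E fA (beta X) c bad fAK (betaK X) fAc bc badA x1 (a1 x1)
  y1E _ a1 fB a1K fBK _ _ erefl _ _ _.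
- by move=> z; rewrite fA1 fA2 /bad !inE => /or4P[] ->; rewrite ?orbT.
- by move=> z /fA_off.
- by move=> z zb; rewrite fA_off ?fB_off.
- by rewrite fA1 fA2.
- by rewrite fB1 fA2.
- by rewrite fB2 fA1.
- by move=> sub; left=> x y /b1/sub.
- by move=> sub; right=> x y /b1/sub.
Qed.

Let dart1 (o : option E) : E * bool := if o is Some e then (e, true) else x1.1.
Let dart2 (o : option E) : E * bool := if o is Some e then (e, false) else (a1 x1).1.
(** [None] stands for the choice of [fB]. Its transposition must precede [rotA], as in
    [rot_swap_arcs], so [rotA] sits in the factor of [None] and the initial permutation is
    trivial. *)
Let optrot (o : option E) : {perm E * bool} := if o is Some _ then 1%g else rotA.
Let optenum : seq (option E) := None :: map Some (enum E).
Let optperm := switch_perm optenum dart1 dart2 optrot 1%g.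
Let some_part (X' : {set option E}) : {set E} := [set e | Some e \in X'].

Lemma optpermE (X' : {set option E}) :
  optperm X' = ((if None \in X' then rotB else rotA) * edge_swap (some_part X'))%g.
Proof.
rewrite /optperm /switch_perm mul1g big_cons big_map; congr (_ * _)%g.
  by case: ifP => _ /=; rewrite ?rot_swap_arcs // mul1g.
by apply: eq_bigr => e _; rewrite mulg1 inE.
Qed.

Let opt_trans X' : bool := class_transitive (dart_comp a1 c) (optperm X').

Lemma opt_transP (X' : {set option E}) :
  reflect (bdry_connected a1 (if None \in X' then fB else fA) (some_part X'))
  (opt_trans X').
Proof.
rewrite /opt_trans optpermE; case: ifP => _; apply: class_transitive_bdry => //.
- apply: (swap_arcs_conn a1K a1_neq y1E y2E' y2x1).
  exact: connect_trans x12 (conn_a1 _ _).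
- by apply: (swap_arcs_conn a1K a1_neq y1E y2E x2E).
Qed.

Lemma quasi_tree_opt X : quasi_tree G X = [exists X' : {set option E}, opt_trans X' && (some_part X' == X)].
Proof.
apply/(quasi_treeP _ ok)/existsP.
  move/pseudo_bdry_connected => [] H.
    exists [set Some e | e in X]; apply/andP.
    have XE : some_part [set Some e | e in X] = X.
      by apply/setP => e; rewrite inE mem_imset // => ? ? [].
    split; last by rewrite XE.
    apply/opt_transP; rewrite XE (_ : None \in _ = false) //.
    by apply/negP => /imsetP[].
  exists (None |: [set Some e | e in X]); apply/andP.
  have XE : some_part (None |: [set Some e | e in X]) = X.
    by apply/setP => e; rewrite !inE /= mem_imset // => ? ? [].
  by split; [apply/opt_transP; rewrite XE !inE | rewrite XE].
case=> X' /andP[/opt_transP H /eqP <-]; apply/pseudo_bdry_connected.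
by move: H; case: ifP; auto.
Qed.

Let optenum_uniq : uniq optenum.
Proof.
rewrite /= map_inj_uniq ?enum_uniq ?andbT; last by move=> ? ? [].
by apply/mapP => -[].
Qed.

Let optenum_full o : o \in optenum.
Proof.
by case: o => [e|]; rewrite inE //=; apply/mapP; exists e; rewrite ?mem_enum.
Qed.

Let dart12_neq o : dart1 o != dart2 o.
Proof.
case: o => [e|] /=; first by rewrite xpair_eqE andbF.
by apply: contraNneq (a1_neq x1) => E0; rewrite -[a1 x1](pos_flagK c0) // -E0 pos_flagK.
Qed.

Let dart12_comp o : dart_comp a1 c (dart1 o) = dart_comp a1 c (dart2 o).
Proof.
case: o => [e|] /=; first exact: dart_comp_edge.
by apply/(dart_compP _ a1K); rewrite !pos_flagK //; apply: conn_a1.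
Qed.

Let optrot_comp o z : dart_comp a1 c (optrot o z) = dart_comp a1 c z.
Proof.
case: o => [e|] /=; first by rewrite perm1.
by apply: dart_comp_rot => //; apply: (swap_arcs_conn a1K a1_neq y1E y2E x2E).
Qed.

Let opt_trans_odd X' Y' : opt_trans X' -> opt_trans Y' -> odd #|X'| = odd #|Y'|.
Proof.
by apply: class_transitive_switch_odd => // z; rewrite perm1.
Qed.

Lemma card_opt (A : {set option E}) : #|A| = ((None \in A) + #|some_part A|)%N.
Proof.
rewrite (cardsD1 None); congr (_ + _)%N.
have Some_injE : injective (@Some E) by move=> ? ? [].
rewrite -(card_imset _ Some_injE); apply: eq_card => o.
apply/idP/imsetP => [|[e]].
  by case: o => [e|]; rewrite !inE //= => eA; exists e; rewrite ?inE.
by rewrite inE => eA ->; rewrite !inE.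
Qed.

Lemma sdist_opt (Q' X' : {set option E}) : sdist Q' X' =
  (sdist (some_part Q') (some_part X') + ((None \in Q') (+) (None \in X')))%N.
Proof.
rewrite /sdist card_opt addnC; congr (_ + _)%N; first by apply: eq_card => e; rewrite !inE.
by rewrite !inE; case: (None \in Q'); case: (None \in X').
Qed.

(** All transitive sets have sizes of one parity, so the remaining elements decide whether [None]
    belongs to the set; each quasi-tree is thus counted once. *)
Lemma some_part_inj : {in opt_trans &, injective some_part}.
Proof.
move=> X' Y' tX tY E0; have := opt_trans_odd tX tY.
rewrite (card_opt X') (card_opt Y') E0 !oddD => /addIb NE.
apply/setP => -[e|]; first by move/setP/(_ e): E0; rewrite !inE.
by move: NE; case: (None \in X'); case: (None \in Y').
Qed.

Lemma pseudo_orientable_ulc Q : ultra_log_concave (qseq G Q) /\ no_internal_zeros (qseq G Q).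
Proof.
pose p := if [pick X' : {set option E} | opt_trans X'] is Some X' then odd #|X'| else false.
have pE X' : opt_trans X' -> odd #|X'| = p.
  move=> tX; rewrite /p; case: pickP => [Y' tY|/(_ X')]; last by rewrite tX.
  exact: opt_trans_odd.
(* Membership of [None] is chosen to make all distances from [Q'] to transitive sets even. The
   distance is then that from [Q] rounded up to an even number, which respects the pairing of
   [2 * i - 1] with [2 * i]. *)
pose Q' : {set option E} := [set o | if o is Some e then e \in Q else odd #|Q| != p].
have Q'E : some_part Q' = Q by apply/setP => e; rewrite !inE.
have even_dist X' : opt_trans X' -> ~~ odd (sdist Q' X').
  move=> tX; rewrite odd_sdist (pE _ tX) card_opt Q'E inE oddD oddb.
  by case: (odd #|Q|); case: (p).
have := @switch_ulc _ _ optenum dart1 dart2 optrot 1%g _ (dart_comp a1 c) optenum_uniq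
  optenum_full dart12_neq dart12_comp optrot_comp _ Q'.
move=> H; apply: ulc_ext (H _); last by move=> z; rewrite perm1.
move=> i; rewrite -(card_in_imset (f := some_part)); last first.
  by move=> X' Y'; rewrite !inE => /andP[tX _] /andP[tY _]; apply: some_part_inj.
have dist_iff X' : opt_trans X' ->
    (sdist Q' X' == 2 * i)%N || ((sdist Q' X').+1 == 2 * i)%N =
    (sdist Q (some_part X') == 2 * i)%N || ((sdist Q (some_part X')).+1 == 2 * i)%N.
  move/even_dist; rewrite sdist_opt Q'E; case: (_ (+) _); lia.
apply: eq_card => X; rewrite inE quasi_tree_opt; apply/andP/imsetP.
  move=> [/existsP[X' /andP[tX /eqP XE]] dX]; exists X'; rewrite // inE.
  by apply/andP; split=> //; rewrite dist_iff // XE.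
move=> [X']; rewrite inE => /andP[tX dX] ->; split; last by rewrite dist_iff in dX.
by apply/existsP; exists X'; apply/andP; split=> //; exact: tX.
Qed.

End PseudoOrientable.

Theorem theorem1p4 (E : finType) (G : ribbon_graph E) (Q : {set E}) :
  ribbon_ok G -> pseudo_orientable G ->
  ultra_log_concave (qseq G Q) /\ no_internal_zeros (qseq G Q).
Proof.
move=> ok /(pseudo_orientable_coloring ok)[c [c0 c2 [c1|[x1 [x2 [x12 []]]]]]].
  exact: orientable_ulc c1.
by move=> *; apply: (@pseudo_orientable_ulc E G c x1 x2).
Qed.
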